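(* Let $(U_{i,j})_{1\le i\le j}$ be an infinite triangular array of i.i.d. random variables with common law $\mathcal{L}$ supported on $[0,\infty)$, with mean $1$ and variance $\sigma^2=\int_0^\infty (x-1)^2\,\mathcal{L}(dx)$. For each $n\ge 1$ let $K=K^{(n)}$ be the $n\times n$ random reversible Markov kernel on the complete graph with loops on $\{1,\dots,n\}$ with weights $U_{i,j}$, as defined in the context, and let $r_k^{\mathbf U}(i)=(K^k)_{i,i}$ be the probability that the random walk on $\{1,\dots,n\}$ with kernel $K$ started at $i$ returns to $i$ after $k$ steps. If $0<\sigma^2<\infty$ and $\mathcal{L}$ has finite fourth moment, then almost surely, for every integer $k\ge0$, $$\lim_{n\to\infty}n^{-1+\frac k2}\left(\sum_{i=1}^n r_k^{\mathbf U}(i)-1\right)=\begin{cases}0&\text{if $k$ is odd}\\ \dfrac{\sigma^k}{k/2+1}\dbinom{k}{k/2}&\text{if $k$ is even.}\end{cases}$$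
   Context: Set $U_{j,i}=U_{i,j}$. For each $n$ and $1\le i\le n$ let $\rho_i=\sum_{j=1}^n U_{i,j}$ (this depends on $n$). The kernel $K=(K_{i,j})_{1\le i,j\le n}$ is given by $K_{i,j}=U_{i,j}/\rho_i$ if $\rho_i>0$; if $\rho_{i}=0$, then $K_{i,j}=0$ for $j\ne i$ and $K_{i,i}=1$. All matrices ($n\ge1$) are built from the same infinite array, so they live on a common probability space. The quantity $r_k^{\mathbf U}(i)$ is for the frozen (fixed) realization of the weights and depends on $n$. *)

(* Defs.v *)
From mathcomp Require Import all_boot all_order all_algebra finmap.
From mathcomp Require Import all_classical all_reals all_analysis.

Set Implicit Arguments.
Unset Strict Implicit.
Unset Printing Implicit Defensive.

Import Order.TTheory GRing.Theory Num.Theory.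
Import numFieldNormedType.Exports.

Local Open Scope classical_set_scope.
Local Open Scope ring_scope.

Definition independent_RVs (d d' : measure_display) (T : measurableType d)
    (T' : measurableType d') (R : realType) (P : probability T R)
    (I : choiceType) (D : set I) (X : I -> {RV P >-> T'}) : Prop :=
  forall (J : {fset I}) (B : I -> set T'),
    [set` J] `<=` D ->
    (forall i, i \in J -> measurable (B i)) ->
    P (\bigcap_(i in [set` J]) (X i @^-1` B i)) =
    (\prod_(i <- J) P (X i @^-1` B i))%E.

(* The law is only compared on measurable sets: the value of a measure on
   other sets is irrelevant. *)
Definition has_law (d d' : measure_display) (T : measurableType d)
    (T' : measurableType d') (R : realType) (P : probability T R)
    (L : probability T' R) (X : {RV P >-> T'}) : Prop :=
  forall A : set T', measurable A -> distribution P X A = L A.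

(* Only the entries U i j with 1 <= i <= j are constrained (and, through
   [weight], used). *)
Definition iid_triangular_array (d : measure_display) (T : measurableType d)
    (R : realType) (P : probability T R)
    (L : probability (measurableTypeR R) R)
    (U : nat -> nat -> {RV P >-> measurableTypeR R}) : Prop :=
  independent_RVs [set p : nat * nat | (1 <= p.1 <= p.2)%N]
    (fun p => U p.1 p.2) /\
  (forall i j : nat, (1 <= i <= j)%N -> has_law L (U i j)).

Definition law_mean (R : realType) (L : probability (measurableTypeR R) R)
    : \bar R :=
  (\int[L]_x x%:E)%E.

(* The variance, when the law has mean 1. *)
Definition law_variance (R : realType) (L : probability (measurableTypeR R) R)
    : \bar R :=
  (\int[L]_x ((x - 1) ^+ 2)%:E)%E.

Definition law_sigma (R : realType) (L : probability (measurableTypeR R) R)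
    : R :=
  Num.sqrt (fine (law_variance L)).

Section FrozenWeights.
Variables (R : realType) (u : nat -> nat -> R).

(* Symmetric extension of the entries on and above the diagonal. *)
Definition weight (i j : nat) : R := u (minn i j) (maxn i j).

Variable n : nat.

(* The ordinal i : 'I_n stands for the state i + 1 of {1, ..., n}. *)
Definition rho (i : 'I_n) : R := \sum_(j < n) weight i.+1 j.+1.

Definition kernel_mx : 'M[R]_n :=
  \matrix_(i, j) (if 0 < rho i then weight i.+1 j.+1 / rho i
                  else (i == j)%:R).

Definition return_prob (k : nat) (i : 'I_n) : R := (kernel_mx ^+ k) i i.

End FrozenWeights.

(* Main.v *)
Require Import Defs.
From mathcomp Require Import all_boot all_order all_algebra finmap.
From mathcomp Require Import all_classical all_reals all_analysis.
From mathcomp Require Import measurable_realfun.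
From mathcomp Require Import ring lra zify.
Set Implicit Arguments.
Unset Strict Implicit.
Unset Printing Implicit Defensive.
Import Order.TTheory GRing.Theory Num.Theory.
Import numFieldNormedType.Exports.
Local Open Scope classical_set_scope.
Local Open Scope ring_scope.

(** Write [x = U - 1] for the centred weights and [X] for their [n x n] matrix.
    Let [T l] be the matrix whose [(i, j)] entry sums the products of [x] along
    the self-avoiding paths of length [l] from [i] to [j].  Prepending an edge
    to a self-avoiding path gives, after scaling [X] by [sqrt n],
      [X T(l) = T(l+1) + sigma^2 T(l-1) + error],
    where the error gathers paths closing a cycle, and paths with a pendant edge
    carrying the centred weight [x^2 - sigma^2].  All these monomials have
    distinct edges, hence are orthogonal in [L^2] unless they have the same edges;
    fourth moments of [U] therefore suffice to bound the expected squared
    Frobenius norms, with no truncation.  Since [T 0 = 1] and [T l] has zero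
    diagonal for [l > 0], iterating the recursion gives the trace of [X^k] as a
    ballot number, i.e. a Catalan number.

    The bounds hold almost surely along [n = m^q], by summability of [m^-2].
    Taking [q] large yields an operator norm [O(n^(1/2 + eps))], first along
    [m^q] and then for every [n] because [X] is a submatrix of a larger one.
    The trace asymptotics pass from [n = m^4] to every [n] because the trace
    of a power changes little when few rows and columns are removed.  Finally
    [sqrt n (K - 1 pi)], with [pi] the invariant law, is [X / sqrt n] up to a
    perturbation of bounded rank and a diagonal factor close to the identity. *)

(** * Frobenius and operator norms *)

(** Along [n = m ^ q] the almost sure bounds lose a factor [m] in Frobenius norm, and two values of
    [q] serve two purposes. For the operator norm, iterating the recursion [k] times loses
    [m ^ k.+1]; with [q = k] this is at most [n ^ 2] whatever [k] is, so that the [k]-th root leaves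
    only a small power of [n]. Consecutive sizes then differ by a bounded factor, which is enough
    for a norm but not for a limit. For the traces [q = 4]: the gap between consecutive sizes is of
    order [n ^ (3/4)], and the error, by Cauchy-Schwarz [sqrt n] times [m], is also of order
    [n ^ (3/4)], both up to a small power of [n]. The operator norm alone bounds a single row sum by
    slightly more than [n], too weak to keep the degrees away from 0. A further square-free sum,
    over pairs of distinct entries of a row, gives row sums of order [n ^ (15/16)] uniformly over
    the rows. The kernel is not symmetric, so it is compared with the centred matrix through traces
    only, perturbations being measured in trace norm. *)

Section Frobenius.
Variable R : realType.
Implicit Types m n p : nat.

(** Lagrange's identity: the double sum of the squares of [a i * b j - a j * b i] is twice the
    gap. *)
Lemma sum_cauchy_schwarz (I : finType) (a b : I -> R) :
  (\sum_i a i * b i) ^+ 2 <= (\sum_i a i ^+ 2) * (\sum_i b i ^+ 2).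
Proof.
have h : 0 <= \sum_i \sum_j (a i * b j - a j * b i) ^+ 2.
  by apply: sumr_ge0 => i _; apply: sumr_ge0 => j _; exact: sqr_ge0.
have e : \sum_i \sum_j (a i * b j - a j * b i) ^+ 2 =
   ((\sum_i a i ^+ 2) * (\sum_i b i ^+ 2)) *+ 2 - ((\sum_i a i * b i) ^+ 2) *+ 2.
  transitivity (\sum_i \sum_j (a i ^+ 2 * b j ^+ 2 + a j ^+ 2 * b i ^+ 2
      - (a i * b i * (a j * b j)) *+ 2)).
    by apply: eq_bigr => i _; apply: eq_bigr => j _; ring.
  under eq_bigr do rewrite sumrB big_split /= sumrMnl -!mulr_sumr -!mulr_suml.
  rewrite sumrB big_split /= sumrMnl -mulr_suml -mulr_sumr -mulr_suml.
  by rewrite -(expr2 (\sum_i a i * b i)); ring.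
by move: h; rewrite e; lra.
Qed.

Definition frob m n (A : 'M[R]_(m, n)) : R :=
  Num.sqrt (\sum_i \sum_j A i j ^+ 2).

Lemma frob_sqr m n (A : 'M[R]_(m, n)) : frob A ^+ 2 = \sum_i \sum_j A i j ^+ 2.
Proof.
rewrite sqr_sqrtr //.
by apply: sumr_ge0 => i _; apply: sumr_ge0 => j _; exact: sqr_ge0.
Qed.

Lemma frob_ge0 m n (A : 'M[R]_(m, n)) : 0 <= frob A.
Proof. exact: sqrtr_ge0. Qed.

Lemma frob0 m n : frob (0 : 'M[R]_(m, n)) = 0.
Proof.
rewrite /frob big1 ?sqrtr0 // => i _; rewrite big1 // => j _.
by rewrite mxE expr0n.
Qed.

Lemma frob_tr m n (A : 'M[R]_(m, n)) : frob A^T = frob A.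
Proof.
rewrite /frob exchange_big /=; congr Num.sqrt.
by apply: eq_bigr => i _; apply: eq_bigr => j _; rewrite mxE.
Qed.

Lemma frob_dot m n (A B : 'M[R]_(m, n)) :
  `|\sum_i \sum_j A i j * B i j| <= frob A * frob B.
Proof.
rewrite -(@ler_pXn2r _ 2) ?nnegrE ?mulr_ge0 ?frob_ge0 // exprMn !frob_sqr.
by rewrite !pair_bigA /= real_normK ?num_real //; exact: sum_cauchy_schwarz.
Qed.

Lemma frobD m n (A B : 'M[R]_(m, n)) : frob (A + B) <= frob A + frob B.
Proof.
rewrite -(@ler_pXn2r _ 2) ?nnegrE ?addr_ge0 ?frob_ge0 //.
rewrite sqrrD !frob_sqr.
have -> : \sum_i \sum_j (A + B) i j ^+ 2 = \sum_i \sum_j A i j ^+ 2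
   + (\sum_i \sum_j A i j * B i j) *+ 2 + \sum_i \sum_j B i j ^+ 2.
  rewrite -sumrMnl -!big_split /=; apply: eq_bigr => i _.
  rewrite -sumrMnl -!big_split /=; apply: eq_bigr => j _.
  by rewrite mxE sqrrD.
rewrite lerD2r lerD2l lerMn2r /=.
by rewrite (le_trans (ler_norm _))// frob_dot.
Qed.

Lemma frobZ m n a (A : 'M[R]_(m, n)) : frob (a *: A) = `|a| * frob A.
Proof.
rewrite /frob -sqrtr_sqr -sqrtrM ?sqr_ge0 // mulr_sumr; congr Num.sqrt.
apply: eq_bigr => i _; rewrite mulr_sumr.
by apply: eq_bigr => j _; rewrite mxE exprMn.
Qed.

Lemma frob_sum m n (I : Type) (r : seq I) (Q : pred I) (F : I -> 'M[R]_(m, n)) :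
  frob (\sum_(i <- r | Q i) F i) <= \sum_(i <- r | Q i) frob (F i).
Proof.
elim/big_ind2 : _ => //; first by rewrite frob0.
by move=> A a B b Aa Bb; apply: le_trans (frobD _ _) (lerD Aa Bb).
Qed.

Lemma frobM m n p (A : 'M[R]_(m, n)) (B : 'M[R]_(n, p)) :
  frob (A *m B) <= frob A * frob B.
Proof.
rewrite -(@ler_pXn2r _ 2) ?nnegrE ?mulr_ge0 ?frob_ge0 // exprMn !frob_sqr.
rewrite [X in _ <= _ * X]exchange_big mulr_suml /=; apply: ler_sum => i _.
rewrite mulr_sumr; apply: ler_sum => j _.
by rewrite mxE; exact: sum_cauchy_schwarz.
Qed.

Lemma normr_tr_mul_le m n (A : 'M[R]_(m, n)) (B : 'M[R]_(n, m)) :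
  `|\tr (A *m B)| <= frob A * frob B.
Proof.
rewrite -(frob_tr B); apply: le_trans (frob_dot _ _).
rewrite /mxtrace le_eqVlt; apply/orP; left; apply/eqP; congr Num.norm.
by apply: eq_bigr => i _; rewrite mxE; apply: eq_bigr => j _; rewrite mxE.
Qed.

Lemma normr_mxE_le m n (A : 'M[R]_(m, n)) i j : `|A i j| <= frob A.
Proof.
rewrite -(@ler_pXn2r _ 2) ?nnegrE ?frob_ge0 // frob_sqr real_normK ?num_real //.
rewrite (bigD1 i) //= (bigD1 j) //= -addrA lerDl addr_ge0 //.
  by apply: sumr_ge0 => *; exact: sqr_ge0.
by apply: sumr_ge0 => ? _; apply: sumr_ge0 => *; exact: sqr_ge0.
Qed.

Lemma frob_const1 n : frob (const_mx 1 : 'cV[R]_n) = Num.sqrt n%:R.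
Proof.
rewrite /frob; congr Num.sqrt.
under eq_bigr do rewrite big_ord1 mxE expr1n.
by rewrite sumr_const card_ord.
Qed.

Lemma frob_delta m n i j : frob (delta_mx i j : 'M[R]_(m, n)) = 1.
Proof.
rewrite -[RHS]sqrtr1 /frob; congr Num.sqrt.
rewrite (bigD1 i) //= (bigD1 j) //= mxE !eqxx expr1n !big1 ?addr0 //.
  by move=> k ki; rewrite big1 // => l _; rewrite mxE (negPf ki) expr0n.
by move=> k kj; rewrite mxE (negPf kj) andbF expr0n.
Qed.

Lemma expmxS n (A : 'M[R]_n) k : A ^+ k.+1 = A *m A ^+ k.
Proof. exact: exprS. Qed.

Lemma expmxSr n (A : 'M[R]_n) k : A ^+ k.+1 = A ^+ k *m A.
Proof. exact: exprSr. Qed.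

Definition opb m n (A : 'M[R]_(m, n)) (c : R) :=
  forall v : 'cV[R]_n, frob (A *m v) <= c * frob v.

Lemma opb_frob m n (A : 'M[R]_(m, n)) : opb A (frob A).
Proof. by move=> v; exact: frobM. Qed.

Lemma opb_le m n (A : 'M[R]_(m, n)) c c' : c <= c' -> opb A c -> opb A c'.
Proof. by move=> h H v; apply: le_trans (H v) _; rewrite ler_wpM2r ?frob_ge0. Qed.

Lemma opb1 n : opb (1%:M : 'M[R]_n) 1.
Proof. by move=> v; rewrite mul1mx mul1r. Qed.

Lemma opbD m n (A B : 'M[R]_(m, n)) a b : opb A a -> opb B b -> opb (A + B) (a + b).
Proof.
move=> Aa Bb v; rewrite mulmxDl mulrDl.
by apply: le_trans (frobD _ _) (lerD (Aa v) (Bb v)).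
Qed.

Lemma opbZ m n (A : 'M[R]_(m, n)) a c : opb A a -> opb (c *: A) (`|c| * a).
Proof. by move=> Aa v; rewrite -scalemxAl frobZ -mulrA ler_wpM2l. Qed.

Lemma opbM m n p (A : 'M[R]_(m, n)) (B : 'M[R]_(n, p)) a b :
  0 <= a -> opb A a -> opb B b -> opb (A *m B) (a * b).
Proof.
move=> a0 Aa Bb v; rewrite -mulmxA -mulrA.
by apply: le_trans (Aa _) _; rewrite ler_wpM2l.
Qed.

Lemma opbX n (A : 'M[R]_n) a k : 0 <= a -> opb A a -> opb (A ^+ k) (a ^+ k).
Proof.
move=> a0 Aa; elim: k => [|k IH]; first exact: opb1.
by rewrite !exprS; exact: opbM.
Qed.

Lemma opb_rank1 m n (u : 'cV[R]_m) (w : 'cV[R]_n) :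
  opb (u *m w^T) (frob u * frob w).
Proof. by apply: opb_le (opb_frob _); rewrite -(frob_tr w); exact: frobM. Qed.

Lemma opb_diag n (d : 'rV[R]_n) c : 0 <= c -> (forall i, `|d 0 i| <= c) -> opb (diag_mx d) c.
Proof.
move=> c0 dc v.
rewrite -(@ler_pXn2r _ 2) ?nnegrE ?mulr_ge0 ?frob_ge0 // exprMn !frob_sqr.
rewrite mulr_sumr; apply: ler_sum => i _; rewrite !big_ord1 mul_diag_mx mxE.
rewrite exprMn ler_wpM2r ?sqr_ge0 // -real_normK ?num_real //.
by rewrite ler_pXn2r ?nnegrE.
Qed.

Lemma opb_trmx_mul_le m n (Q : 'M[R]_(m, n)) q (u : 'cV[R]_n) (w : 'cV[R]_m) :
  opb Q q -> `|\tr (u *m w^T *m Q)| <= q * frob u * frob w.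
Proof.
move=> Qq; rewrite -mulmxA mxtrace_mulC -mulmxA.
apply: le_trans (normr_tr_mul_le _ _) _; rewrite frob_tr mulrC.
by rewrite ler_wpM2r ?frob_ge0.
Qed.

Lemma opb_diag_entry_le n (Q : 'M[R]_n) q i : opb Q q -> `|Q i i| <= q.
Proof.
move=> /(_ (delta_mx i 0)); rewrite frob_delta mulr1; apply: le_trans.
by rewrite -colE; apply: le_trans (normr_mxE_le _ i 0); rewrite mxE.
Qed.

Lemma opb_row_le m n (Q : 'M[R]_(m, n)) q i : opb Q^T q ->
  \sum_j Q i j ^+ 2 <= q ^+ 2.
Proof.
move=> /(_ (delta_mx i 0)); rewrite frob_delta mulr1 -colE => h.
have <- : frob (col i Q^T) ^+ 2 = \sum_j Q i j ^+ 2.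
  by rewrite frob_sqr; apply: eq_bigr => j _; rewrite big_ord1 !mxE.
by rewrite ler_pXn2r ?nnegrE ?frob_ge0 // (le_trans (frob_ge0 _) h).
Qed.

Lemma opb_tr_diag_mul_le n (d : 'rV[R]_n) (Q : 'M[R]_n) q :
  opb Q q -> `|\tr (diag_mx d *m Q)| <= (\sum_i `|d 0 i|) * q.
Proof.
move=> Qq; rewrite /mxtrace (le_trans (ler_norm_sum _ _ _)) // mulr_suml.
apply: ler_sum => i _; rewrite mul_diag_mx mxE normrM ler_wpM2l //.
exact: opb_diag_entry_le.
Qed.

Lemma frob_opb n (Q : 'M[R]_n) q : opb Q q -> frob Q <= q * Num.sqrt n%:R.
Proof.
(* In dimension 0 the hypothesis does not force [q] to be non-negative. *)
case: n Q => [|n] Q Qq; first by rewrite /frob big_ord0 sqrtr0 mulr0.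
have q0 : 0 <= q by rewrite (le_trans _ (opb_diag_entry_le 0 Qq)).
rewrite -(@ler_pXn2r _ 2) ?nnegrE ?mulr_ge0 ?frob_ge0 ?sqrtr_ge0 // exprMn.
rewrite frob_sqr sqr_sqrtr ?ler0n // exchange_big /=.
have -> : q ^+ 2 * n.+1%:R = \sum_(i < n.+1) q ^+ 2.
  by rewrite sumr_const card_ord mulr_natr.
apply: ler_sum => i _.
have -> : \sum_j Q j i ^+ 2 = frob (col i Q) ^+ 2.
  by rewrite frob_sqr; apply: eq_bigr => j _; rewrite big_ord1 mxE.
rewrite ler_pXn2r ?nnegrE ?frob_ge0 //.
by have := Qq (delta_mx i 0); rewrite frob_delta mulr1 -colE.
Qed.

(** A power [B] of a symmetric matrix is symmetric, so the square of [frob (B *m v)] is the inner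
    product of [v] and [B *m B *m v]; Cauchy-Schwarz doubles the exponent at each induction step. *)
Lemma frobX n (A : 'M[R]_n) v s : A^T = A ->
  frob (A *m v) ^+ (2 ^ s) <= frob (v : 'cV_n) ^+ (2 ^ s).-1 * frob (A ^+ (2 ^ s) *m v).
Proof.
move=> symA; elim: s => [|s IH]; first by rewrite expn0 expr1 expr0 mul1r expr1.
have symX k : (A ^+ k)^T = A ^+ k.
  elim: k => [|k ih]; first by rewrite expr0 [LHS]trmx1.
  rewrite {1}exprS [LHS]trmx_mul ih symA; exact/esym/exprSr.
set B := A ^+ (2 ^ s) in IH *.
have hB : frob (B *m v) ^+ 2 <= frob v * frob (B *m B *m v).
  have -> : frob (B *m v) ^+ 2 = \tr (v^T *m (B *m B *m v)).
    have -> : v^T *m (B *m B *m v) = (B *m v)^T *m (B *m v).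
      by rewrite trmx_mul symX !mulmxA.
    rewrite frob_sqr /mxtrace exchange_big; apply: eq_bigr => j _.
    by rewrite [RHS]mxE; apply: eq_bigr => i _; rewrite [in RHS]mxE expr2.
  by rewrite -(frob_tr v) (le_trans (ler_norm _)) // normr_tr_mul_le.
have -> : A ^+ (2 ^ s.+1) = B *m B by rewrite expnS mul2n -addnn exprD.
have : (frob (A *m v) ^+ (2 ^ s)) ^+ 2 <=
       (frob v ^+ (2 ^ s).-1 * frob (B *m v)) ^+ 2.
  by rewrite ler_pXn2r ?nnegrE ?mulr_ge0 ?exprn_ge0 ?frob_ge0.
rewrite -exprM -expnSr => /le_trans; apply.
rewrite exprMn (le_trans (ler_wpM2l _ hB)) ?exprn_ge0 ?frob_ge0 //.
rewrite mulrA -exprM -exprSr.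
have -> : ((2 ^ s).-1 * 2).+1 = (2 ^ s.+1).-1.
  by rewrite expnS; have := expn_gt0 2 s; lia.
by [].
Qed.

(** Replaces the spectral theorem: a norm bound on a high power of a symmetric matrix descends to
    the matrix by taking a root. *)
Lemma opb_power_trick n (A : 'M[R]_n) s c : A^T = A -> 0 <= c ->
  opb (A ^+ (2 ^ s)) (c ^+ (2 ^ s)) -> opb A c.
Proof.
move=> symA c0 h v.
rewrite -(@ler_pXn2r _ (2 ^ s)) ?nnegrE ?mulr_ge0 ?frob_ge0 ?expn_gt0 //.
apply: le_trans (frobX _ _ symA) _; rewrite exprMn.
apply: le_trans (ler_wpM2l _ (h v)) _; first by rewrite exprn_ge0 ?frob_ge0.
by rewrite mulrCA -exprSr prednK ?expn_gt0.
Qed.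

End Frobenius.

(** * Self-avoiding paths *)

Section TupleSums.
Variables (R : nmodType) (T : finType).

Lemma big_tuple_cons l (P : pred (seq T)) (F : seq T -> R) :
  \sum_(s : l.+1.-tuple T | P s) F s =
  \sum_i \sum_(s : l.-tuple T | P (i :: s)) F (i :: s).
Proof.
rewrite pair_big_dep /=.
rewrite (reindex (fun p : T * l.-tuple T => [tuple of p.1 :: p.2])) /=.
  by apply: eq_bigl => -[i s].
exists (fun s : l.+1.-tuple T => (thead s, [tuple of behead s])) => [[i s]|s] _.
  by congr pair; apply: val_inj.
by case/tupleP: s => i s; apply: val_inj.
Qed.

Lemma big_tuple0 (P : pred (seq T)) (F : seq T -> R) :
  \sum_(s : 0.-tuple T | P s) F s = if P [::] then F [::] else 0.
Proof.
rewrite big_mkcond /= (bigD1 [tuple]) //= big1 ?addr0 // => s.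
by case/eqP; exact: tuple0.
Qed.

End TupleSums.

Section Paths.
Variable R : realType.

Fixpoint pprod (T : Type) (x : T -> T -> R) (i : T) (s : seq T) : R :=
  if s is j :: s' then x i j * pprod x j s' else 1.

Variables (n : nat) (x : 'I_n -> 'I_n -> R).

Definition xmx : 'M[R]_n := \matrix_(i, j) x i j.

Definition path_mx l : 'M[R]_n := \matrix_(i, j)
  \sum_(s : l.-tuple 'I_n | uniq (i :: s) && (last i s == j)) pprod x i s.

(* The new first vertex [a] closes a cycle other than a backtracking. *)
Definition cycle_mx l : 'M[R]_n := \matrix_(a, j)
  \sum_(s : l.+1.-tuple 'I_n |
     [&& uniq s, a \in (s : seq _) & index a s != 1%N] && (last a s == j)) pprod x a s.

(* Only used for [l > 0], where [head s] is the pendant vertex. *)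
Definition pendant_mx (c : R) l : 'M[R]_n := \matrix_(a, j)
  \sum_(s : l.-tuple 'I_n | uniq (a :: s) && (last a (behead s) == j))
     ((x a (head a s) ^+ 2 - c) * pprod x a (behead s)).

Hypothesis x_sym : forall i j, x i j = x j i.

Lemma path_mx0 : path_mx 0 = 1%:M.
Proof.
apply/matrixP => i j; rewrite !mxE.
rewrite (big_tuple0 (fun s => uniq (i :: s) && (last i s == j)) (pprod x i)) /=.
by case: (i == j).
Qed.

Lemma path_mx_tr l : \tr (path_mx l.+1) = 0.
Proof.
rewrite /mxtrace big1 // => i _; rewrite mxE big1 // => s.
case/tupleP: s => a s /andP[/= /andP[+ _] /eqP e].
by rewrite -e mem_last.
Qed.

Lemma mul_xmx_path_mxE l a j : (xmx *m path_mx l) a j =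
  \sum_(s : l.+1.-tuple 'I_n | uniq s && (last a s == j)) pprod x a s.
Proof.
rewrite mxE (big_tuple_cons l (fun s => uniq s && (last a s == j)) (pprod x a)) /=.
by apply: eq_bigr => i _; rewrite !mxE mulr_sumr.
Qed.

(** Three ways of prepending [a] to a self-avoiding path [s]: [a] is new; [a] is the second vertex,
    so that the first edge is walked back and forth; [a] occurs elsewhere and closes a cycle, or a
    loop when it is the head. *)
Lemma mul_xmx_path_mx_split l a j : (xmx *m path_mx l) a j =
  path_mx l.+1 a j + cycle_mx l a j +
  \sum_(s : l.+1.-tuple 'I_n | [&& uniq s, index a s == 1%N, a \in (s : seq _) & last a s == j])
     pprod x a s.
Proof.
rewrite mul_xmx_path_mxE !mxE.
rewrite (bigID (fun s : l.+1.-tuple 'I_n => a \in (s : seq _))) /= addrC -addrA.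
congr +%R.
  apply: eq_bigl => s /=; by case: (a \in _); case: (uniq _); case: (_ == _).
rewrite (bigID (fun s : l.+1.-tuple 'I_n => index a s == 1%N)) /= addrC; congr +%R;
  apply: eq_bigl => s /=; by case: (a \in _); case: (uniq _); case: (last _ _ == _); case: (index _ _ == _).
Qed.

Lemma mul_xmx_path_mx0 : xmx *m path_mx 0 = path_mx 1 + cycle_mx 0.
Proof.
apply/matrixP => a j; rewrite mul_xmx_path_mx_split [RHS]mxE big_pred0 ?addr0 // => s.
apply/negbTE/negP => /and4P[_ /eqP e]; rewrite -index_mem e size_tuple ltnn //.
Qed.

(** A backtracking word is [i :: a :: q] with product [x a i ^+ 2 * pprod x a q]. Writing
    [x a i ^+ 2] as [c] plus a centred term, the [c] part no longer depends on [i], which ranges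
    over the [n - l.+1] vertices outside [a :: q]. *)
Lemma mul_xmx_path_mxS (c : R) l : xmx *m path_mx l.+1 =
  path_mx l.+2 + cycle_mx l.+1 +
  ((c * (n%:R - l.+1%:R)) *: path_mx l + pendant_mx c l.+1).
Proof.
apply/matrixP => a j; rewrite mul_xmx_path_mx_split [RHS]mxE [in RHS]mxE; congr +%R.
rewrite (big_tuple_cons l.+1 (fun s => [&& uniq s, index a s == 1%N, a \in s & last a s == j]) (pprod x a)).
under eq_bigr => i _ do rewrite (big_tuple_cons l (fun s => [&& uniq (i :: s),
   index a (i :: s) == 1%N, a \in i :: s & last a (i :: s) == j]) (fun s => pprod x a (i :: s))).
transitivity (\sum_i \sum_(q : l.-tuple 'I_n | uniq (i :: a :: q) && (last a q == j))
   (x a i ^+ 2 * pprod x a q)).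
  apply: eq_bigr => i _; rewrite (bigD1 a) //= [X in _ + X]big1 ?addr0; last first.
    move=> b ba; rewrite big_pred0 // => q.
    by rewrite /=; case: (i == a); rewrite ?(negPf ba) /= ?andbF.
  apply: eq_big => [q|q _]; last by rewrite mulrA (x_sym i a) expr2.
  rewrite eqxx !inE eqxx !negb_or orbT /=.
  by have [->|] := eqVneq i a; rewrite ?eqxx ?andbF //=.
rewrite !mxE (big_tuple_cons l (fun s => uniq (a :: s) && (last a (behead s) == j))
   (fun s => (x a (head a s) ^+ 2 - c) * pprod x a (behead s))) /=.
rewrite mulr_sumr.
have -> : \sum_(s : l.-tuple 'I_n | (a \notin (s : seq _)) && uniq s && (last a s == j))
    c * (n%:R - l.+1%:R) * pprod x a s =
  \sum_i \sum_(q : l.-tuple 'I_n | uniq (i :: a :: q) && (last a q == j)) c * pprod x a q.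
  rewrite (exchange_big_dep (fun q : l.-tuple 'I_n => (a \notin (q : seq _)) && uniq q && (last a q == j))) /=; last first.
    by move=> i q _; rewrite inE negb_or => /andP[/and3P[_ -> ->] ->].
  apply: eq_bigr => q /andP[/andP[aq uq] lq].
  rewrite (eq_bigl [predC a :: q]); last first.
    by move=> i; rewrite /= aq uq lq !andbT.
  rewrite sumr_const.
  have := cardC (mem (a :: q)); rewrite (card_uniqP _) /= ?aq // size_tuple card_ord.
  move=> e; have -> : n%:R - l.+1%:R = #|[predC a :: q]|%:R :> R.
    by rewrite -[in LHS]e natrD addrAC subrr add0r.
  by rewrite mulrAC mulr_natr; congr (_ *+ _); apply: eq_card => i; rewrite !inE.
rewrite -big_split /=; apply: eq_bigr => i _.
rewrite [X in _ = _ + X](eq_bigl (fun s : l.-tuple 'I_n =>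
  [&& i \notin a :: s, a \notin (s : seq _) & uniq s] && (last a s == j))) /=; last first.
  move=> q; rewrite !inE !negb_or (eq_sym a i).
  by case: (i == a); case: (a \in _) => //=; rewrite ?andbF.
rewrite -big_split /=; apply: eq_bigr => q _; ring.
Qed.

End Paths.

(** * Ballot numbers *)

Section Ballot.

(* The number of walks of length [k] on the half-line [nat] from 0 to [l]. *)
Fixpoint ballot (k l : nat) : nat :=
  match k, l with
  | 0, 0 => 1
  | 0, _.+1 => 0
  | k'.+1, 0 => ballot k' 1
  | k'.+1, l'.+1 => ballot k' l' + ballot k' l'.+2
  end.

Lemma ballotSS k l : ballot k.+1 l.+1 = (ballot k l + ballot k l.+2)%N.
Proof. by []. Qed.

Lemma ballot_gt k l : (k < l)%N -> ballot k l = 0%N.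
Proof.
elim: k l => [|k IH] [|l] //= kl.
by rewrite !IH //; lia.
Qed.

Lemma ballot_odd k l : odd (k + l) -> ballot k l = 0%N.
Proof.
elim: k l => [|k IH] [|l] //=; first by move=> h; apply: IH; move: h; lia.
by move=> h; rewrite !IH //; move: h; lia.
Qed.

(** Reflection principle: the walks that leave the half-line are counted by the previous binomial
    coefficient, read as 0 when [q = 0]. It is added on the left to avoid a truncated
    subtraction. *)
Lemma ballot_reflection k l q : k = (l + q.*2)%N ->
  (ballot k l + (if q is q'.+1 then 'C(k, q') else 0) = 'C(k, q))%N.
Proof.
elim: k l q => [|k IH] [|l] [|q] //.
- move=> e /=; rewrite binS.
  have h := IH 1%N q ltac:(lia).
  (* Here [l = 0], so [k = q.*2.+1] and these are the two central coefficients. *)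
  have -> : 'C(k, q.+1) = 'C(k, q) by rewrite -bin_sub; [congr binomial; lia | lia].
  case: q e h => [|q] e h; first by rewrite !bin0 in h *; lia.
  by rewrite binS; lia.
- move=> e /=; have h := IH l 0%N ltac:(lia).
  by rewrite (@ballot_gt k l.+2) ?bin0 in h *; lia.
- move=> e /=.
  have h1 := IH l q.+1 ltac:(lia); have h2 := IH l.+2 q ltac:(lia).
  rewrite binS.
  by case: q e h1 h2 => [|q] e h1 h2; rewrite ?bin0 ?binS; rewrite ?bin0 in h1 h2; lia.
Qed.

Lemma ballot_catalan q : (q.+1 * ballot q.*2 0 = 'C(q.*2, q))%N.
Proof.
have := @ballot_reflection q.*2 0 q erefl.
case: q => [//|q]; move: (ballot _ _) => b h.
have := mul_bin_left q.+1.*2 q.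
have -> : (q.+1.*2 - q = q.+2)%N by lia.
by nia.
Qed.

Variables (R : realType) (n : nat) (X : 'M[R]_n) (T G : nat -> 'M[R]_n) (c : R).
Hypotheses (T0 : T 0%N = 1%:M) (XT0 : X *m T 0%N = T 1%N + G 0%N).
Hypothesis XTS : forall l, X *m T l.+1 = T l.+2 + c ^+ 2 *: T l + G l.+1.

(** Without the error [G], the [T l] would be the monic Chebyshev polynomials of the second kind in
    [X], orthogonal for the semicircle law of variance [c ^+ 2]; at [F = T] this is the expansion of
    [X ^+ k] in them. *)
Definition ballot_comb (F : nat -> 'M[R]_n) k : 'M[R]_n :=
  \sum_(l < k.+1) ((ballot k l)%:R * c ^+ (k - l)) *: F l.

Lemma mul_ballot_comb k : X *m ballot_comb T k = ballot_comb T k.+1 + ballot_comb G k.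
Proof.
rewrite /ballot_comb mulmx_sumr.
transitivity (\sum_(l < k.+1) ((ballot k l)%:R * c ^+ (k - l)) *: (T l.+1 + G l)
  + \sum_(l < k) ((ballot k l.+1)%:R * c ^+ (k - l.+1)) *: (c ^+ 2 *: T l)).
  rewrite big_ord_recl [X in _ = X + _]big_ord_recl -addrA /=.
  congr (_ + _); first by rewrite -scalemxAr XT0.
  rewrite -big_split /=; apply: eq_bigr => l _.
  by rewrite -scalemxAr XTS -scalerDr -addrA (addrC (_ *: T _)) addrA.
under eq_bigr do rewrite scalerDr.
rewrite big_split /= addrAC; congr (_ + _).
rewrite [RHS]big_ord_recl.
case: k => [|k]; first by rewrite !big_ord1 big_ord0 /= mul0r scale0r addr0 add0r.
rewrite [X in _ + X = _]big_ord_recl addrCA; congr (_ + _).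
  by rewrite scalerA -mulrA -exprD; congr ((_ * _ ^+ _) *: _); rewrite /=; lia.
have -> : \sum_(i < k.+2) ((ballot k.+2 (lift ord0 i))%:R * c ^+ (k.+2 - lift ord0 i)) *: T (lift ord0 i)
  = \sum_(i < k.+2) ((ballot k.+1 i)%:R * c ^+ (k.+1 - i)) *: T i.+1
   + \sum_(i < k.+2) ((ballot k.+1 i.+2)%:R * c ^+ (k.+1 - i)) *: T i.+1.
  rewrite -big_split; apply: eq_bigr => i _.
  by rewrite lift0 subSS ballotSS natrD mulrDl scalerDl.
congr (_ + _).
(* The two topmost terms vanish since a walk of length [m] cannot end beyond [m]; this aligns the
   ranges of the sums. *)
have z m i : (m <= i)%N -> ((ballot m i.+2)%:R * c ^+ (m - i)) *: T i.+1 = 0.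
  by move=> mi; rewrite ballot_gt ?mul0r ?scale0r //; lia.
rewrite [RHS]big_ord_recr z // [RHS]addr0 [RHS]big_ord_recr.
rewrite [X in _ = _ _ X](_ : _ = 0); last by rewrite ballot_gt ?mul0r ?scale0r //=.
rewrite [RHS]addr0.
apply: eq_bigr => i _; rewrite lift0 scalerA -mulrA -exprD; congr ((_ * _ ^+ _) *: _).
by rewrite /=; have := ltn_ord i; lia.
Qed.

(** Duhamel's formula: the error committed at step [j] is carried along by the [k.-1 - j] remaining
    multiplications. *)
Lemma exp_ballot_expansion k :
  X ^+ k = ballot_comb T k + \sum_(j < k) X ^+ (k.-1 - j) *m ballot_comb G j.
Proof.
elim: k => [|k IH].
  by rewrite big_ord0 addr0 /ballot_comb big_ord1 /= mulr1 scale1r T0.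
rewrite expmxS IH mulmxDr mul_ballot_comb -addrA; congr (_ + _).
rewrite big_ord_recr /= subnn expr0 [1 *m _]mul1mx addrC; congr (_ + _).
rewrite mulmx_sumr; apply: eq_bigr => j _.
by rewrite mulmxA -expmxS; congr (_ ^+ _ *m _); have := ltn_ord j; lia.
Qed.

End Ballot.

(** * Growth along powers and trace asymptotics *)

Section Domination.
Variables (R : realType) (I : Type).
Implicit Types f g h : I -> R.

(** An upper bound in the sense of big O, with one constant for all indices instead of
    eventually. *)
Definition dominated f g := exists2 C, 0 <= C & forall i, f i <= C * g i.

Lemma dominated_le f f' g : (forall i, f i <= f' i) -> dominated f' g -> dominated f g.
Proof. by move=> h [C C0 H]; exists C => // i; exact: le_trans (H i). Qed.

Lemma dominated_trans f g g' : (forall i, g i <= g' i) -> dominated f g -> dominated f g'.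
Proof.
by move=> h [C C0 H]; exists C => // i; apply: le_trans (H i) _; rewrite ler_wpM2l.
Qed.

Lemma dominatedD f f' g : dominated f g -> dominated f' g -> dominated (fun i => f i + f' i) g.
Proof.
move=> [C C0 H] [C' C0' H']; exists (C + C'); first exact: addr_ge0.
by move=> i; rewrite mulrDl lerD.
Qed.

Lemma dominatedM f f' g g' : (forall i, 0 <= f i) -> (forall i, 0 <= f' i) ->
  dominated f g -> dominated f' g' -> dominated (fun i => f i * f' i) (fun i => g i * g' i).
Proof.
move=> f0 f0' [C C0 H] [C' C0' H']; exists (C * C'); first exact: mulr_ge0.
by move=> i; rewrite mulrACA ler_pM.
Qed.

Lemma dominatedZ a f g : 0 <= a -> dominated f g -> dominated (fun i => a * f i) g.
Proof.
move=> a0 [C C0 H]; exists (a * C); first exact: mulr_ge0.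
by move=> i; rewrite -mulrA ler_wpM2l.
Qed.

Lemma dominated_sum (J : Type) (r : seq J) (Q : pred J) (f : J -> I -> R) g :
  (forall i, 0 <= g i) ->
  (forall j, Q j -> dominated (f j) g) -> dominated (fun i => \sum_(j <- r | Q j) f j i) g.
Proof.
move=> g0 H; elim: r => [|j r IH].
  by exists 0 => // i; rewrite big_nil mul0r.
have [Qj|Qj] := boolP (Q j).
  apply: dominated_le (dominatedD (H j Qj) IH) => i; by rewrite big_cons Qj.
by apply: dominated_le IH => i; rewrite big_cons (negPf Qj).
Qed.

Lemma dominated_sqr f g : (forall i, 0 <= f i) -> (forall i, 0 <= g i) ->
  dominated (fun i => f i ^+ 2) (fun i => g i ^+ 2) -> dominated f g.
Proof.
move=> f0 g0 [C C0 H]; exists (Num.sqrt C); first exact: sqrtr_ge0.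
move=> i; rewrite -(@ler_pXn2r _ 2) ?nnegrE ?mulr_ge0 ?sqrtr_ge0 //.
by rewrite exprMn sqr_sqrtr.
Qed.

End Domination.

Section Deterministic.
Variables (R : realType) (y : nat -> nat -> R) (c : R).
Hypothesis y_sym : forall i j, y i j = y j i.

Definition trunc n (i j : 'I_n) : R := y i j.
Definition Xmx n : 'M[R]_n := xmx (@trunc n).
Definition sqn n : R := Num.sqrt n%:R.
Definition Ymx n : 'M[R]_n := (sqn n)^-1 *: Xmx n.

Lemma sqn_gt0 n : (0 < n)%N -> 0 < sqn n.
Proof. by move=> n0; rewrite sqrtr_gt0 ltr0n. Qed.

Lemma sqn_sqr n : sqn n ^+ 2 = n%:R.
Proof. by rewrite sqr_sqrtr. Qed.

Lemma Xmx_tr n : (Xmx n)^T = Xmx n.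
Proof. by apply/matrixP => i j; rewrite !mxE /trunc y_sym. Qed.

Lemma Ymx_tr n : (Ymx n)^T = Ymx n.
Proof. by rewrite /Ymx linearZ /= Xmx_tr. Qed.

Definition Tmx n l : 'M[R]_n := (sqn n) ^- l *: path_mx (@trunc n) l.

(** Only [n - l] vertices are available for a backtracking edge, while the limiting recursion counts
    [n]; the last term corrects for this. *)
Definition Gmx n l : 'M[R]_n := (sqn n) ^- l.+1 *:
  (if l is l'.+1 then cycle_mx (@trunc n) l + pendant_mx (@trunc n) (c ^+ 2) l
      - (c ^+ 2 * l%:R) *: path_mx (@trunc n) l'
   else cycle_mx (@trunc n) 0).

Lemma Tmx0 n : Tmx n 0 = 1%:M.
Proof. by rewrite /Tmx path_mx0 expr0 invr1 scale1r. Qed.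

Lemma mul_Ymx_Tmx0 n : Ymx n *m Tmx n 0 = Tmx n 1 + Gmx n 0.
Proof.
rewrite /Ymx /Tmx /Gmx -scalemxAl -scalemxAr mul_xmx_path_mx0 expr0 invr1 scale1r expr1.
exact: scalerDr.
Qed.

Lemma mul_Ymx_TmxS n l : (0 < n)%N ->
  Ymx n *m Tmx n l.+1 = Tmx n l.+2 + c ^+ 2 *: Tmx n l + Gmx n l.+1.
Proof.
move=> n0; have s0 := gt_eqF (sqn_gt0 n0).
have sym i j : @trunc n i j = @trunc n j i by exact: y_sym.
rewrite /Ymx /Tmx /Gmx -scalemxAl -scalemxAr (mul_xmx_path_mxS sym (c ^+ 2)).
rewrite scalerA -invfM -exprS.
have -> : c ^+ 2 *: (sqn n ^- l *: path_mx (@trunc n) l) =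
  sqn n ^- l.+2 *: ((c ^+ 2 * n%:R) *: path_mx (@trunc n) l).
  rewrite !scalerA -sqn_sqr; congr (_ *: _).
  have := expf_neq0 l (negbT s0).
  rewrite -[l.+2]addn2 exprD; move: (sqn n ^+ l) => u u0; field.
  by rewrite u0 (negbT s0).
rewrite -!scalerDr; congr (_ *: _).
rewrite mulrBr scalerBl -!addrA; congr (_ + _).
rewrite addrCA [RHS]addrCA; congr (_ + _).
by rewrite addrCA; congr (_ + _); rewrite addrC.
Qed.

(* The almost sure form, along [n = m ^ q], of a mean of order [n ^ a]: the
   loss [m ^ 2] makes the exceptional probabilities summable. *)
Definition growth (q : nat) (Z : nat -> R) (a : nat) := exists2 K, 0 <= K &
  forall m, Z (m.+1 ^ q)%N <= K * m.+1%:R ^+ 2 * (m.+1 ^ q)%:R ^+ a.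

Hypothesis path_growth : forall q l,
  growth q (fun n => frob (path_mx (@trunc n) l) ^+ 2) l.+1.
Hypothesis cycle_growth : forall q l,
  growth q (fun n => frob (cycle_mx (@trunc n) l) ^+ 2) l.+1.
Hypothesis pendant_growth : forall q l,
  growth q (fun n => frob (pendant_mx (@trunc n) (c ^+ 2) l.+1) ^+ 2) l.+2.

(** Since [n ^ (a + b)] is the square of [sqn ^ (a + b)], normalising by [sqn ^ a] leaves [sqn ^ b],
    and the loss [m ^ 2] becomes [m]. *)
Lemma growth_sqrt q (Z : nat -> R) a b :
  (forall n, 0 <= Z n) -> growth q (fun n => Z n ^+ 2) (a + b) ->
  dominated (fun m => sqn (m.+1 ^ q)%N ^- a * Z (m.+1 ^ q)%N)
            (fun m => m.+1%:R * sqn (m.+1 ^ q)%N ^+ b).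
Proof.
move=> Z0 [K K0 H].
have s0 m : 0 < sqn (m.+1 ^ q)%N by apply: sqn_gt0; rewrite expn_gt0.
apply: dominated_sqr => [m|m|].
- by rewrite mulr_ge0 // invr_ge0 exprn_ge0 // ltW.
- by rewrite mulr_ge0 // exprn_ge0 // ltW.
exists K => // m; rewrite exprMn exprVn mulrC ler_pdivrMr ?exprn_gt0 //.
apply: le_trans (H m) _; rewrite le_eqVlt; apply/orP; left; apply/eqP.
rewrite -[(m.+1 ^ q)%:R]sqn_sqr; move: (sqn _) => s.
have -> : (s ^+ 2) ^+ (a + b) = (s ^+ b) ^+ 2 * (s ^+ a) ^+ 2.
  by rewrite -!exprM -exprD; congr (_ ^+ _); lia.
ring.
Qed.

Lemma Tmx_dominated q l : dominated (fun m => frob (Tmx (m.+1 ^ q) l))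
  (fun m => m.+1%:R * sqn (m.+1 ^ q)).
Proof.
have h : growth q (fun n => frob (path_mx (@trunc n) l) ^+ 2) (l + 1) by rewrite addn1.
have := growth_sqrt (fun n => frob_ge0 _) h.
apply: dominated_le => m.
by rewrite frobZ ger0_norm // invr_ge0 exprn_ge0 // sqrtr_ge0.
Qed.

(** The error is smaller than [Tmx] by a factor [sqn]: the cycle sums have the same order of growth
    as the path sums but are divided by one more [sqn]. *)
Lemma Gmx_dominated q l : dominated (fun m => frob (Gmx (m.+1 ^ q) l)) (fun m => m.+1%:R).
Proof.
have e (F : forall n, 'M[R]_n) a : growth q (fun n => frob (F n) ^+ 2) a ->
   dominated (fun m => frob ((sqn (m.+1 ^ q)) ^- a *: F (m.+1 ^ q)%N)) (fun m => m.+1%:R).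
  rewrite -{1}[a]addn0 => h; have := growth_sqrt (fun n => frob_ge0 (F n)) h.
  move=> h'; apply: dominated_trans (dominated_le _ h') => [m|m].
    by rewrite expr0 mulr1.
  by rewrite frobZ ger0_norm // invr_ge0 exprn_ge0 // sqrtr_ge0.
have M0 m : 0 <= m.+1%:R :> R by [].
case: l => [|l]; first exact: e (cycle_growth q 0).
apply: dominated_le (dominatedD (dominatedD (e _ _ (cycle_growth q l.+1))
  (e _ _ (pendant_growth q l))) (dominatedZ (normr_ge0 (c ^+ 2 * l.+1%:R)) (e (fun n => path_mx (@trunc n) l) l.+2 _))).
  move=> m; rewrite /Gmx !scalerDr.
  apply: le_trans (frobD _ _) _; apply: lerD; first exact: frobD.
  by rewrite -scaleNr scalerA mulrC -scalerA frobZ normrN lexx.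
(* [path_mx l] grows one power of [n] more slowly than the scaling allows. *)
have [K K0 H] := path_growth q l; exists K => // m.
apply: le_trans (H m) _; rewrite ler_wpM2l //; first by rewrite mulr_ge0 ?exprn_ge0.
by rewrite ler_weXn2l // ler1n expn_gt0.
Qed.

(** Strong induction on [k]: the main term is of order [m * sqn], and in Duhamel's formula each
    error multiplies a lower power by one more factor [m]. *)
Lemma Ymx_exp_dominated q k : dominated (fun m => frob (Ymx (m.+1 ^ q) ^+ k))
  (fun m => m.+1%:R ^+ k.+1 * sqn (m.+1 ^ q)).
Proof.
have M1 m : 1 <= m.+1%:R :> R by rewrite ler1n.
have s0 m : 0 <= sqn (m.+1 ^ q) by exact: sqrtr_ge0.
have comb_dominated F g j : (forall m, 0 <= g m) ->
    (forall l, dominated (fun m => frob (F m l : 'M[R]_(m.+1 ^ q))) g) ->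
    dominated (fun m => frob (ballot_comb c (F m) j)) g.
  move=> g0 H; apply: dominated_le (fun m => frob_sum _ _ _) _.
  apply: dominated_sum => // l _.
  apply: dominated_le (dominatedZ (normr_ge0 ((ballot j l)%:R * c ^+ (j - l))) (H l)) => m.
  by rewrite frobZ.
elim/ltn_ind: k => k IH.
apply: dominated_le (dominatedD (_ : dominated (fun m => frob (ballot_comb c (Tmx (m.+1 ^ q)) k)) _)
  (_ : dominated (fun m => \sum_(j < k) (frob (Ymx (m.+1 ^ q) ^+ (k.-1 - j)) *
     frob (ballot_comb c (Gmx (m.+1 ^ q)) j))) _)).
- move=> m; have n0 : (0 < m.+1 ^ q)%N by rewrite expn_gt0.
  rewrite (exp_ballot_expansion (Tmx0 _) (mul_Ymx_Tmx0 _) (fun l => mul_Ymx_TmxS l n0)).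
  apply: le_trans (frobD _ _) _; rewrite lerD2l.
  apply: le_trans (frob_sum _ _ _) _; apply: ler_sum => j _; exact: frobM.
- apply: comb_dominated => [m|l]; first by rewrite mulr_ge0 // exprn_ge0.
  apply: dominated_trans (Tmx_dominated q l) => m.
  by rewrite ler_wpM2r // -[leLHS]expr1 ler_weXn2l.
- apply: dominated_sum => [m|j _]; first by rewrite mulr_ge0 // exprn_ge0.
  have lt_k : (k.-1 - j < k)%N by have := ltn_ord j; lia.
  have hG : dominated (fun m => frob (ballot_comb c (Gmx (m.+1 ^ q)) j)) (fun m => m.+1%:R).
    by apply: comb_dominated => // l; exact: Gmx_dominated.
  apply: dominated_trans (dominatedM _ _ (IH _ lt_k) hG) => m; try exact: frob_ge0.
  by rewrite mulrAC -exprSr ler_wpM2r // ler_weXn2l.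
Qed.

End Deterministic.

(** * Traces of powers: perturbation and restriction to a submatrix *)

Section TraceComparison.
Variable R : realType.

Lemma opb_trmx m n (A : 'M[R]_(m, n)) a : 0 <= a -> opb A a -> opb A^T a.
Proof.
move=> a0 Aa v.
have : frob (A^T *m v) ^+ 2 <= a * frob v * frob (A^T *m v).
  have -> : frob (A^T *m v) ^+ 2 = \tr (v^T *m (A *m (A^T *m v))).
    have -> : v^T *m (A *m (A^T *m v)) = (A^T *m v)^T *m (A^T *m v).
      by rewrite trmx_mul trmxK !mulmxA.
    rewrite frob_sqr /mxtrace exchange_big; apply: eq_bigr => j _.
    by rewrite [RHS]mxE; apply: eq_bigr => i _; rewrite [in RHS]mxE expr2.
  apply: le_trans (ler_norm _) _; apply: le_trans (normr_tr_mul_le _ _) _.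
  by rewrite frob_tr mulrC mulrAC ler_wpM2r ?frob_ge0.
have := frob_ge0 (A^T *m v); rewrite le_eqVlt => /predU1P[<- _|f0].
  by rewrite mulr_ge0 ?frob_ge0.
by rewrite expr2 ler_pM2r.
Qed.

Lemma expmxZ n a (A : 'M[R]_n) k : (a *: A) ^+ k = a ^+ k *: A ^+ k.
Proof.
elim: k => [|k IH]; first by rewrite !expr0 scale1r.
by rewrite !expmxS IH -scalemxAl -scalemxAr scalerA exprS.
Qed.

(** The difference [A - B] is controlled only when traced against a matrix of bounded operator norm;
    each of the [k] telescoping terms is such a trace, with [k.-1] further factors of norm at most
    [c]. *)
Lemma tr_telescope n (A B : 'M[R]_n) (c tau : R) k : 0 <= c -> opb A c -> opb B c ->
  (forall Q q, 0 <= q -> opb Q q -> `|\tr ((A - B) *m Q)| <= tau * q) ->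
  `|\tr (A ^+ k) - \tr (B ^+ k)| <= k%:R * tau * c ^+ k.-1.
Proof.
move=> c0 Ac Bc AB.
(* A test matrix [Q] makes the induction go through: the leading factor [A] is moved cyclically to
   the right of [Q]. *)
suff H Q q : 0 <= q -> opb Q q ->
    `|\tr ((A ^+ k - B ^+ k) *m Q)| <= k%:R * tau * c ^+ k.-1 * q.
  have := H _ _ ler01 (@opb1 R n); rewrite mulmx1 mulr1.
  by rewrite linearB.
elim: k Q q => [|k IH] Q q q0 Qq; first by rewrite !expr0 subrr mul0mx linear0 normr0 !mul0r.
have -> : A ^+ k.+1 - B ^+ k.+1 = A *m (A ^+ k - B ^+ k) + (A - B) *m B ^+ k.
  by rewrite !expmxS mulmxBr mulmxBl addrA subrK.
rewrite mulmxDl linearD /= -(mulmxA A) mxtrace_mulC -(mulmxA _ Q A) -(mulmxA (A - B)).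
apply: le_trans (ler_normD _ _) _.
have h1 := IH (Q *m A) (q * c) (mulr_ge0 q0 c0) (opbM q0 Qq Ac).
have h2 := AB (B ^+ k *m Q) (c ^+ k * q) (mulr_ge0 (exprn_ge0 k c0) q0)
  (opbM (exprn_ge0 k c0) (opbX k c0 Bc) Qq).
apply: le_trans (lerD h1 h2) _; rewrite le_eqVlt; apply/orP; left; apply/eqP.
case: k {IH h1 h2} => [|k]; first by rewrite !mul0r add0r expr0 !mul1r !mulr1.
by rewrite /= -natr1 exprSr; ring.
Qed.

Lemma next_power k n : (0 < n)%N -> (0 < k)%N ->
  exists m, [/\ (0 < m)%N, (m ^ k <= n)%N & (n < m.+1 ^ k)%N].
Proof.
move=> n0 k0.
have ex : exists m, (m ^ k <= n)%N by exists 0%N; rewrite exp0n.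
have ub m : (m ^ k <= n -> m <= n)%N.
  by apply: leq_trans; case: m => // m; rewrite -[leqLHS]expn1 leq_pexp2l.
case: (ex_maxnP ex ub) => m mn max_m; exists m; split => //.
  by apply: max_m; rewrite exp1n.
by rewrite ltnNge; apply/negP => /max_m; rewrite ltnn.
Qed.

End TraceComparison.

Section Truncation.
Variables (R : realType) (y : nat -> nat -> R).
Variables (n N : nat).
Hypothesis nN : (n <= N)%N.

Definition selmx : 'M[R]_(n, N) := \matrix_(i, j) (i == j :> nat)%:R.

Lemma selmx_mulE p (A : 'M[R]_(N, p)) i j : (selmx *m A) i j = A (widen_ord nN i) j.
Proof.
rewrite mxE (bigD1 (widen_ord nN i)) //= mxE eqxx mul1r big1 ?addr0 // => k ki.
rewrite mxE; case: eqP => [e|_]; last by rewrite mul0r.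
by case/eqP: ki; apply: val_inj; rewrite /= e.
Qed.

Lemma mul_selmx_trE p (A : 'M[R]_(p, N)) i j : (A *m selmx^T) i j = A i (widen_ord nN j).
Proof.
rewrite mxE (bigD1 (widen_ord nN j)) //= !mxE eqxx mulr1 big1 ?addr0 // => k kj.
rewrite !mxE; case: eqP => [e|_]; last by rewrite mulr0.
by case/eqP: kj; apply: val_inj; rewrite /= e.
Qed.

Lemma Xmx_sel : Xmx y n = selmx *m Xmx y N *m selmx^T.
Proof. by apply/matrixP => i j; rewrite mul_selmx_trE selmx_mulE !mxE. Qed.

Lemma opb_selmx : opb selmx 1.
Proof.
move=> v; rewrite mul1r -(@ler_pXn2r _ 2) ?nnegrE ?frob_ge0 // !frob_sqr.
under eq_bigr do rewrite big_ord1 selmx_mulE.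
under [leRHS]eq_bigr do rewrite big_ord1.
rewrite -(big_ord_narrow (F := fun i => v i 0 ^+ 2) nN) [leRHS](bigID (fun i : 'I_N => (i < n)%N)) /=.
by rewrite lerDl sumr_ge0 // => i _; exact: sqr_ge0.
Qed.

Lemma opb_Xmx_le c : 0 <= c -> opb (Xmx y N) c -> opb (Xmx y n) c.
Proof.
move=> c0 h; rewrite Xmx_sel -[c]mul1r -[1 * c]mulr1.
apply: opbM; rewrite ?mul1r //; last exact: opb_trmx opb_selmx.
by have := opbM ler01 opb_selmx h; rewrite mul1r.
Qed.

Definition sel_proj : 'M[R]_N := selmx^T *m selmx.

Lemma sub1_sel_proj : 1%:M - sel_proj = diag_mx (\row_j (n <= j)%N%:R).
Proof.
apply/matrixP => i j; rewrite !mxE.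
have -> : \sum_k selmx^T i k * selmx k j = (i == j)%:R * (i < n)%N%:R.
  case: (ltnP i n) => [i_n|n_i].
    rewrite (bigD1 (Ordinal i_n)) //= !mxE /= eqxx mul1r mulr1 big1 ?addr0 // => k.
    rewrite !mxE; case: (eqVneq (k : nat) i) => [e|]; last by rewrite mul0r.
    by case/eqP; apply: val_inj.
  rewrite mulr0 big1 // => k _; rewrite !mxE; case: (eqVneq (k : nat) i) => [e|]; last by rewrite mul0r.
  by have := ltn_ord k; rewrite e ltnNge n_i.
case: (eqVneq i j) => [->|_]; last by rewrite mul0r subrr mulr0n.
by rewrite [(n <= j)%N]leqNgt; case: (j < n)%N; rewrite /= ?mulr1 ?mulr0 ?subrr ?subr0.
Qed.

Lemma opb_sel_proj : opb sel_proj 1.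
Proof. by have := opbM ler01 (opb_trmx ler01 opb_selmx) opb_selmx; rewrite mul1r. Qed.

(** By cyclicity of the trace; both sizes now live in dimension [N] and can be compared by
    [tr_telescope]. *)
Lemma tr_Xmx_sel k : \tr (Xmx y n ^+ k.+1) = \tr ((Xmx y N *m sel_proj) ^+ k.+1).
Proof.
have -> : Xmx y n ^+ k.+1 = selmx *m ((Xmx y N *m sel_proj) ^+ k *m Xmx y N *m selmx^T).
  elim: k => [|k IH].
    by rewrite expr1 expr0 [1 *m _]mul1mx Xmx_sel !mulmxA.
  by rewrite expmxS IH {1}Xmx_sel expmxS /sel_proj !mulmxA.
by rewrite mxtrace_mulC -!mulmxA -/sel_proj -expmxSr.
Qed.

(** [1%:M - sel_proj] is diagonal with [N - n] ones, and the trace of a diagonal matrix against [Q]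
    is at most its absolute sum times the norm of [Q]. *)
Lemma tr_Xmx_sub_le k c : 0 <= c -> opb (Xmx y N) c ->
  `|\tr (Xmx y N ^+ k.+1) - \tr (Xmx y n ^+ k.+1)| <= k.+1%:R * (N - n)%:R * c ^+ k.+1.
Proof.
move=> c0 Xc; rewrite tr_Xmx_sel.
have XPc : opb (Xmx y N *m sel_proj) c by have := opbM c0 Xc opb_sel_proj; rewrite mulr1.
apply: le_trans (tr_telescope k.+1 (tau := (N - n)%:R * c) c0 Xc XPc _) _; last first.
  by rewrite /= exprS !mulrA.
move=> Q q q0 Qq.
have -> : Xmx y N - Xmx y N *m sel_proj = Xmx y N *m diag_mx (\row_j (n <= j)%N%:R).
  by rewrite -sub1_sel_proj mulmxBr mulmx1.
rewrite -mulmxA mxtrace_mulC -mulmxA.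
apply: le_trans (opb_tr_diag_mul_le _ (opbM q0 Qq Xc)) _.
rewrite (mulrC q) mulrA ler_wpM2r // ler_wpM2r //.
under eq_bigr do rewrite mxE normr_nat.
rewrite -natr_sum ler_nat.
have -> : (\sum_(i < N) (n <= i) = \sum_(0 <= i < N) (n <= i))%N by rewrite big_mkord.
rewrite (@big_cat_nat _ _ _ n) //= big1_seq; last first.
  by move=> i /andP[_]; rewrite mem_index_iota => /andP[_]; rewrite ltnNge => /negPf ->.
rewrite add0n; apply: (@leq_trans (\sum_(n <= i < N) 1)%N).
  by apply: leq_sum => i _; case: (n <= i)%N.
by rewrite sum_nat_const_nat muln1.
Qed.

End Truncation.

(** * Rates as powers of small roots of [n], and the operator norm *)

Section Roots.
Variables (R : realType) (p : nat).
Hypothesis p_gt0 : (0 < p)%N.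

(* [root16 n] plays the role of [n ^ eps]; all the rates below are integer
   powers of it, up to constants. *)
Definition root16 n : R := n%:R `^ (16 * p)%:R^-1.

Lemma root16_ge0 n : 0 <= root16 n.
Proof. exact: powR_ge0. Qed.

Lemma root16_exp n : root16 n ^+ (16 * p) = n%:R.
Proof.
rewrite -powR_mulrn ?powR_ge0 // -powRrM mulVf ?powRr1 //.
by rewrite pnatr_eq0; lia.
Qed.

Lemma root16_ge1 n : (0 < n)%N -> 1 <= root16 n.
Proof.
move=> n0; have := @ge0_ler_powR R (16 * p)%:R^-1 _ 1 n%:R.
by rewrite powR1; apply; rewrite ?invr_ge0 ?nnegrE ?ler1n.
Qed.

Lemma root16_scale a n N : (0 < a)%N -> (N <= a * n)%N -> root16 N <= a%:R * root16 n.
Proof.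
move=> a0 le_N; apply: (@le_trans _ _ ((a * n)%:R `^ (16 * p)%:R^-1)).
  by apply: ge0_ler_powR; rewrite ?nnegrE ?invr_ge0 ?ler_nat.
rewrite natrM powRM // ler_wpM2r ?powR_ge0 // ler1_powR ?ler1n //.
by rewrite invf_le1 ?ltr0n ?ler1n; lia.
Qed.

(** This is [n ^ (1/16)]. Up to [p] operator-norm losses [root16] are absorbed by a single [kap],
    and a rate such as [n ^ (3/4 + 1/16)] reads [kap ^ 13]. *)
Definition kap n : R := root16 n ^+ p.

Lemma kap_exp n : kap n ^+ 16 = n%:R.
Proof. by rewrite -exprM mulnC root16_exp. Qed.

Lemma kap_ge0 n : 0 <= kap n.
Proof. by rewrite exprn_ge0 ?root16_ge0. Qed.

Lemma kap_ge1 n : (0 < n)%N -> 1 <= kap n.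
Proof. by move=> n0; rewrite exprn_ege1 // root16_ge1. Qed.

Lemma sqn_kap n : sqn R n = kap n ^+ 8.
Proof.
by rewrite /sqn -kap_exp (exprM _ 8 2) sqrtr_sqr ger0_norm // exprn_ge0 ?kap_ge0.
Qed.

End Roots.

Section OperatorNorm.
Variables (R : realType) (y : nat -> nat -> R) (c : R).
Hypothesis y_sym : forall i j, y i j = y j i.
Hypothesis path_growth : forall q l,
  growth q (fun n => frob (path_mx (@trunc R y n) l) ^+ 2) l.+1.
Hypothesis cycle_growth : forall q l,
  growth q (fun n => frob (cycle_mx (@trunc R y n) l) ^+ 2) l.+1.
Hypothesis pendant_growth : forall q l,
  growth q (fun n => frob (pendant_mx (@trunc R y n) (c ^+ 2) l.+1) ^+ 2) l.+2.
Variable p : nat.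
Hypothesis p_gt0 : (0 < p)%N.

Lemma sqn_scale a n N : (N <= a ^ 2 * n)%N -> sqn R N <= a%:R * sqn R n.
Proof.
move=> h; rewrite -(@ler_pXn2r _ 2) ?nnegrE ?mulr_ge0 ?sqrtr_ge0 //.
by rewrite exprMn !sqn_sqr -natrX -natrM ler_nat.
Qed.

Lemma Xmx_opb : exists2 C, 0 <= C & forall n, (0 < n)%N ->
  opb (Xmx y n) (C * root16 R p n * sqn R n).
Proof.
(* [k] is a power of 2 for the squaring trick, and [48 * p <= k] ensures that [n ^ 3], which is
   [root16 n ^ (48 * p)], is at most [root16 n ^ k]. *)
pose s := (48 * p)%N; pose k := (2 ^ s)%N.
have k0 : (0 < k)%N by rewrite expn_gt0.
have [K K0 H] := Ymx_exp_dominated y_sym path_growth cycle_growth pendant_growth k k.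
(* [8 ^ k] pays for passing from [N ^ 3] to [n ^ 3] with [N <= 2 ^ k * n]; adding 1 gives [1 <= D],
   hence [D <= D ^ k]. *)
pose D := K * 8 ^+ k + 1.
have D1 : 1 <= D by rewrite lerDr mulr_ge0 ?exprn_ge0.
have D0 : 0 <= D by rewrite (le_trans ler01).
exists (2 ^+ k * D) => [|n n0]; first by rewrite mulr_ge0 ?exprn_ge0.
have [m [m0 mk km]] := next_power n0 k0.
have NA : (m.+1 ^ k <= 2 ^ k * n)%N.
  apply: (@leq_trans ((2 * m) ^ k)%N); first by rewrite leq_exp2r //; lia.
  by rewrite expnMn leq_mul2l mk orbT.
set N := (m.+1 ^ k)%N in km NA H *.
have N0 : (0 < N)%N by rewrite expn_gt0.
have t1 := root16_ge1 R p n0.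
have t0 := root16_ge0 R p n.
have bound : frob (Ymx y N ^+ k) <= (D * root16 R p n) ^+ k.
  apply: le_trans (H m) _; rewrite -/N.
  (* The subsequence exponent equals the power, so [m.+1 ^ k] is exactly [N]; the final exponent 3
     does not depend on [k]. *)
  have h3 : m.+1%:R ^+ k.+1 * sqn R N <= N%:R ^+ 3 :> R.
    have mN : m.+1%:R <= N%:R :> R.
      by rewrite ler_nat -[leqLHS]expn1 leq_pexp2l.
    have sN : sqn R N <= N%:R.
      rewrite -[leRHS](sqn_sqr R) expr2 ler_peMr ?sqrtr_ge0 //.
      by rewrite -[1]sqrtr1 ler_sqrt ?ler1n.
    rewrite exprSr -natrX -/N !exprS expr0 mulr1 -mulrA ler_wpM2l //.
    by rewrite ler_pM ?sqrtr_ge0.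
  apply: le_trans (ler_wpM2l K0 h3) _.
  apply: (@le_trans _ _ (D * n%:R ^+ 3)).
    apply: (@le_trans _ _ (K * (8 ^+ k * n%:R ^+ 3))).
      rewrite ler_wpM2l // -natrX -natrX -natrX -natrM ler_nat.
      have -> : (8 ^ k = (2 ^ k) ^ 3)%N by rewrite -expnM mulnC expnM.
      by rewrite -expnMn leq_exp2r.
    by rewrite mulrA ler_wpM2r ?exprn_ge0 // lerDl.
  rewrite exprMn ler_pM ?exprn_ge0 //; first by rewrite -[leLHS]expr1 ler_weXn2l.
  rewrite -[n%:R](root16_exp R p_gt0) -exprM ler_weXn2l //.
  by apply: leq_trans (ltnW (ltn_expl s (ltnSn 1))); rewrite /s; lia.
have Y_op : opb (Ymx y N) (D * root16 R p n).
  apply: (@opb_power_trick _ _ _ s); rewrite ?mulr_ge0 ?Ymx_tr //.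
  exact: opb_le bound (@opb_frob _ _ _ _).
have sN0 : 0 < sqn R N by exact: sqn_gt0.
have X_op : opb (Xmx y N) (sqn R N * (D * root16 R p n)).
  have -> : Xmx y N = sqn R N *: Ymx y N.
    by rewrite scalerA mulfV ?scale1r // gt_eqF.
  by have := opbZ (sqn R N) Y_op; rewrite ger0_norm // ltW.
have s_le : sqn R N <= 2 ^+ k * sqn R n.
  rewrite -natrX; apply: sqn_scale.
  by apply: leq_trans NA _; rewrite leq_mul2r expnS expn1 leq_pmulr ?expn_gt0 ?orbT.
apply: (opb_Xmx_le (ltnW km)); first by rewrite !mulr_ge0 ?exprn_ge0 ?sqrtr_ge0.
apply: opb_le X_op.
apply: le_trans (ler_wpM2r _ s_le) _; first by rewrite mulr_ge0.
by rewrite -!mulrA ler_wpM2l ?exprn_ge0 // mulrC -!mulrA.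
Qed.

End OperatorNorm.

(** * Trace asymptotics by interpolation between fourth powers *)

Section NextFourthPower.

(** The index [i] stands for the size [i.+1], which keeps sizes positive; [root4 i] is the integer
    part of the fourth root of [i.+1]. *)
Definition root4 i : nat := sval (cid (next_power (ltn0Sn i) (isT : (0 < 4)%N))).
Definition nxt i : nat := ((root4 i).+1 ^ 4)%N.

Lemma root4P i : [/\ (0 < root4 i)%N, (root4 i ^ 4 <= i.+1)%N & (i.+1 < nxt i)%N].
Proof. exact: (svalP (cid (next_power (ltn0Sn i) (isT : (0 < 4)%N)))). Qed.

Lemma nxt_le i : (nxt i <= 4 ^ 2 * i.+1)%N.
Proof.
have [m0 mi im] := root4P i.
apply: (@leq_trans ((2 * root4 i) ^ 4)%N); first by rewrite leq_exp2r //; lia.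
by rewrite expnMn leq_mul2l mi orbT.
Qed.

Lemma nxt_gt0 i : (0 < nxt i)%N. Proof. by rewrite expn_gt0. Qed.

Lemma sqn_nxt (R : realType) i : sqn R (nxt i) <= 4 * sqn R i.+1.
Proof. exact: (@sqn_scale R 4 _ _ (nxt_le i)). Qed.

End NextFourthPower.

Section Moments.
Variables (R : realType) (y : nat -> nat -> R) (c : R).
Hypothesis y_sym : forall i j, y i j = y j i.
Hypothesis path_growth : forall q l,
  growth q (fun n => frob (path_mx (@trunc R y n) l) ^+ 2) l.+1.
Hypothesis cycle_growth : forall q l,
  growth q (fun n => frob (cycle_mx (@trunc R y n) l) ^+ 2) l.+1.
Hypothesis pendant_growth : forall q l,
  growth q (fun n => frob (pendant_mx (@trunc R y n) (c ^+ 2) l.+1) ^+ 2) l.+2.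
Variable p : nat.
Hypothesis p_gt0 : (0 < p)%N.

Lemma root16_le_kap i k : (k <= p)%N -> root16 R p i.+1 ^+ k <= kap R p i.+1.
Proof. by move=> kp; rewrite ler_weXn2l // root16_ge1. Qed.

Lemma sqn_ge0 n : 0 <= sqn R n. Proof. exact: sqrtr_ge0. Qed.

Lemma root16_inv_cvg0 : (root16 R p i.+1)^-1 @[i --> \oo] --> (0 : R).
Proof.
apply/cvgrPdist_lt => /= e e0; near=> i.
have t1 := root16_ge1 R p (ltn0Sn i).
have t0 : 0 < root16 R p i.+1 by rewrite (lt_le_trans ltr01).
rewrite sub0r normrN ger0_norm ?invr_ge0 ?root16_ge0 //.
rewrite invf_plt ?posrE // -(@ltr_pXn2r _ (16 * p)) ?nnegrE ?invr_ge0 ?root16_ge0 ?ltW //; last by lia.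
rewrite root16_exp //; apply: (@lt_trans _ _ i%:R); last by rewrite ltr_nat.
near: i; exact: nbhs_infty_gtr.
Unshelve. all: by end_near. Qed.

(** One spare factor [root16] is enough, since it tends to infinity and so beats the constant. *)
Lemma dominated_cvg0 (f g : nat -> R) : (forall i, 0 <= f i) -> dominated f g ->
  (forall i, g i * root16 R p i.+1 <= i.+1%:R) -> f i / i.+1%:R @[i --> \oo] --> 0.
Proof.
move=> f0 [C C0 H] gt.
have h0 : C * (root16 R p i.+1)^-1 @[i --> \oo] --> 0.
  by rewrite -[X in _ --> X](mulr0 C); apply: cvgMr; exact: root16_inv_cvg0.
apply: (squeeze_cvgr _ (cvg_cst 0) h0); near=> i.
have t0 : 0 < root16 R p i.+1 by rewrite (lt_le_trans ltr01) // root16_ge1.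
rewrite divr_ge0 //= ler_pdivrMr ?ltr0n //.
apply: le_trans (H i) _; rewrite -mulrA ler_wpM2l // mulrC ler_pdivlMr //.
Unshelve. all: by end_near. Qed.

Lemma root4_kap i : (root4 i)%:R <= kap R p i.+1 ^+ 4.
Proof.
rewrite -(@ler_pXn2r _ 4) ?nnegrE ?exprn_ge0 ?kap_ge0 ?root16_ge0 //.
rewrite -exprM kap_exp // -natrX ler_nat; by have [] := root4P i.
Qed.

Lemma root4S_dominated : dominated (fun i => (root4 i).+1%:R) (fun i => kap R p i.+1 ^+ 4).
Proof.
exists 2 => // i; apply: (@le_trans _ _ (2 * (root4 i)%:R)).
  by rewrite -natrM ler_nat; have [] := root4P i; lia.
by rewrite ler_wpM2l // root4_kap.
Qed.

Lemma nxt_sub_dominated : dominated (fun i => (nxt i - i.+1)%:R) (fun i => kap R p i.+1 ^+ 12).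
Proof.
(* 15 is the sum 4 + 6 + 4 + 1 of the coefficients of [(m + 1) ^ 4 - m ^ 4], each monomial being at
   most [m ^ 3]. *)
exists 15 => // i; apply: (@le_trans _ _ (15 * (root4 i)%:R ^+ 3)).
  rewrite -natrX -natrM ler_nat; have [m0 mi im] := root4P i.
  apply: (@leq_trans (nxt i - root4 i ^ 4)%N); first by rewrite leq_sub2l.
  rewrite /nxt; move: (root4 i) m0 => m m0; rewrite leq_subLR.
  have := leq_mul m0 (leqnn (m * m * m)); have := leq_mul m0 (leqnn (m * m)).
  have := leq_mul m0 (leqnn m); rewrite !expnS !expn0; nia.
rewrite ler_wpM2l // (exprM _ 4 3); apply: lerXn2r; rewrite ?nnegrE ?exprn_ge0 ?kap_ge0 ?root16_ge0 //.
exact: root4_kap.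
Qed.

Lemma root16_nxt i : root16 R p (nxt i) <= 16 * root16 R p i.+1.
Proof. exact: (@root16_scale R p p_gt0 16 _ _ isT (nxt_le i)). Qed.

Lemma Xmx_nxt_opb : exists2 C, 0 <= C & forall i,
  opb (Xmx y (nxt i)) (C * (root16 R p i.+1 * sqn R i.+1)).
Proof.
have [C C0 H] := Xmx_opb y_sym path_growth cycle_growth pendant_growth p_gt0.
exists (C * (16 * 4)) => [|i]; first by rewrite !mulr_ge0.
apply: opb_le (H _ (nxt_gt0 i)); rewrite -!mulrA ler_wpM2l //.
rewrite [leRHS](_ : _ = (16 * root16 R p i.+1) * (4 * sqn R i.+1)); last by ring.
by rewrite ler_pM ?root16_ge0 ?sqn_ge0 ?root16_nxt ?sqn_nxt.
Qed.

Lemma Ymx_nxt_opb : exists2 C, 0 <= C & forall i, opb (Ymx y (nxt i)) (C * root16 R p i.+1).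
Proof.
have [C C0 H] := Xmx_opb y_sym path_growth cycle_growth pendant_growth p_gt0.
exists (C * 16) => [|i]; first by rewrite mulr_ge0.
have s0 := sqn_gt0 R (nxt_gt0 i).
have := opbZ (sqn R (nxt i))^-1 (H _ (nxt_gt0 i)); apply: opb_le.
rewrite ger0_norm ?invr_ge0 ?sqn_ge0 // mulrC mulfK ?gt_eqF // -mulrA.
by rewrite ler_wpM2l // root16_nxt.
Qed.

Lemma tr_ballot_comb n k :
  \tr (ballot_comb c (Tmx y n) k) = (ballot k 0)%:R * c ^+ k * n%:R.
Proof.
rewrite /ballot_comb linear_sum big_ord_recl /= subn0 Tmx0 linearZ /= mxtrace1 big1 ?addr0 //.
by move=> l _; rewrite /bump leq0n add1n linearZ /= /Tmx linearZ /= path_mx_tr !mulr0.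
Qed.

(** Cauchy-Schwarz for the trace: by the operator norm the powers of [Ymx] have Frobenius norm of
    order [kap * sqn], that is [kap ^ 9], and the errors [Gmx] are of order [m], at most [kap ^ 4].
    Bounding the powers by [Ymx_exp_dominated] would lose a power of [m] that grows with [k]. *)
Lemma tr_Ymx_nxt k : (k <= p)%N ->
  dominated (fun i => `|\tr (Ymx y (nxt i) ^+ k) - (ballot k 0)%:R * c ^+ k * (nxt i)%:R|)
    (fun i => kap R p i.+1 ^+ 13).
Proof.
move=> kp; have k0 i : 0 <= kap R p i.+1 := kap_ge0 R p i.+1.
have [C C0 Yop] := Ymx_nxt_opb.
apply: dominated_le (_ : dominated (fun i => \sum_(j < k) frob (Ymx y (nxt i) ^+ (k.-1 - j)) *
     frob (ballot_comb c (Gmx y c (nxt i)) j)) _).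
  move=> i; rewrite (exp_ballot_expansion (Tmx0 y _) (mul_Ymx_Tmx0 y c _)
    (fun l => mul_Ymx_TmxS c y_sym l (nxt_gt0 i))).
  rewrite linearD /= tr_ballot_comb [X in `|X|]addrC addKr linear_sum.
  apply: le_trans (ler_norm_sum _ _ _) _; apply: ler_sum => j _.
  exact: normr_tr_mul_le.
apply: dominated_sum => [i|j _]; first by rewrite exprn_ge0.
have hY : dominated (fun i => frob (Ymx y (nxt i) ^+ (k.-1 - j))) (fun i => kap R p i.+1 ^+ 9).
  exists (C ^+ (k.-1 - j) * 4) => [|i]; first by rewrite mulr_ge0 ?exprn_ge0.
  have yop0 : 0 <= C * root16 R p i.+1 by rewrite mulr_ge0 ?root16_ge0.
  apply: le_trans (frob_opb (opbX (k.-1 - j) yop0 (Yop i))) _.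
  rewrite exprMn -!mulrA ler_wpM2l ?exprn_ge0 //.
  apply: (@le_trans _ _ (kap R p i.+1 * (4 * sqn R i.+1))).
    rewrite ler_pM ?exprn_ge0 ?root16_ge0 ?sqn_ge0 ?sqn_nxt //.
    by apply: root16_le_kap; lia.
  by rewrite (@sqn_kap R p) // mulrCA -exprS.
have hG : dominated (fun i => frob (ballot_comb c (Gmx y c (nxt i)) j)) (fun i => kap R p i.+1 ^+ 4).
  apply: dominated_le (fun i => frob_sum _ _ _) _.
  apply: dominated_sum => [i|l _]; first by rewrite exprn_ge0.
  apply: dominated_le (dominatedZ (normr_ge0 ((ballot j l)%:R * c ^+ (j - l)))
    (_ : dominated (fun i => frob (Gmx y c (nxt i) l)) _)) => [i|].
    by rewrite frobZ.
  have [K K0 H] := Gmx_dominated path_growth cycle_growth pendant_growth 4 l.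
  have [K' K0' H'] := root4S_dominated.
  exists (K * K') => [|i]; first exact: mulr_ge0.
  by apply: le_trans (H (root4 i)) _; rewrite -mulrA ler_wpM2l.
apply: dominated_trans (dominatedM _ _ hY hG) => i; try exact: frob_ge0.
by rewrite -exprD.
Qed.

(** The submatrix comparison concerns the unscaled [Xmx], so changing the scale from [nxt i] to
    [i.+1] leaves a ratio of square roots in the main term. Removing rows costs [kap ^ 12] for their
    number and [root16 ^ k.+1], at most [kap], for the norms. *)
Lemma tr_Xmx_estimate k : (k < p)%N ->
  dominated (fun i => `|\tr (Ymx y i.+1 ^+ k.+1) -
       (ballot k.+1 0)%:R * c ^+ k.+1 * (nxt i)%:R * (sqn R (nxt i) / sqn R i.+1) ^+ k.+1|)
    (fun i => kap R p i.+1 ^+ 13).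
Proof.
move=> kp; have k0 i : 0 <= kap R p i.+1 := kap_ge0 R p i.+1.
have scale n : (0 < n)%N -> \tr (Xmx y n ^+ k.+1) = sqn R n ^+ k.+1 * \tr (Ymx y n ^+ k.+1).
  move=> n0; have s0 := sqn_gt0 R n0.
  have e : Xmx y n = sqn R n *: Ymx y n by rewrite scalerA mulfV ?scale1r // gt_eqF.
  by rewrite {1}e expmxZ linearZ.
have [C C0 Xop] := Xmx_nxt_opb.
have h1 : dominated (fun i => `|\tr (Xmx y (nxt i) ^+ k.+1) - \tr (Xmx y i.+1 ^+ k.+1)| / sqn R i.+1 ^+ k.+1)
     (fun i => kap R p i.+1 ^+ 13).
  have [K K0 H] := nxt_sub_dominated.
  exists (k.+1%:R * K * C ^+ k.+1) => [|i]; first by rewrite !mulr_ge0 ?exprn_ge0.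
  have s0 : 0 < sqn R i.+1 ^+ k.+1 by rewrite exprn_gt0 // sqn_gt0.
  rewrite ler_pdivrMr //.
  have [_ _ /ltnW le_n] := root4P i.
  apply: le_trans (tr_Xmx_sub_le le_n _ _ (Xop i)) _.
    by rewrite !mulr_ge0 ?root16_ge0 ?sqn_ge0.
  rewrite !exprMn -!mulrA ler_wpM2l //.
  rewrite [leRHS](_ : _ = (K * kap R p i.+1 ^+ 12) * (C ^+ k.+1 * (kap R p i.+1 * sqn R i.+1 ^+ k.+1))); last by ring.
  rewrite ler_pM ?mulr_ge0 ?exprn_ge0 ?root16_ge0 ?sqn_ge0 //.
  rewrite ler_wpM2l ?exprn_ge0 // ler_wpM2r ?exprn_ge0 ?sqn_ge0 //.
  exact: root16_le_kap.
have [K K0 H] := tr_Ymx_nxt kp.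
have h2 : dominated (fun i => `|\tr (Ymx y (nxt i) ^+ k.+1) - (ballot k.+1 0)%:R * c ^+ k.+1 * (nxt i)%:R|
      * (sqn R (nxt i) / sqn R i.+1) ^+ k.+1) (fun i => kap R p i.+1 ^+ 13).
  exists (K * 4 ^+ k.+1) => [|i]; first by rewrite mulr_ge0 ?exprn_ge0.
  rewrite [leRHS]mulrAC ler_pM ?exprn_ge0 ?divr_ge0 ?sqn_ge0 //.
  by apply: lerXn2r; rewrite ?nnegrE ?divr_ge0 ?sqn_ge0 // ler_pdivrMr ?sqn_gt0 ?sqn_nxt.
apply: dominated_le (dominatedD h1 h2) => i.
have s0 := sqn_gt0 R (ltn0Sn i).
rewrite !scale ?nxt_gt0 //.
have sk : sqn R i.+1 ^+ k.+1 != 0 by rewrite expf_neq0 // gt_eqF.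
set a := \tr (Ymx y i.+1 ^+ k.+1); set b := \tr _; set z := _ * (nxt i)%:R.
rewrite expr_div_n.
have -> : a - z * (sqn R (nxt i) ^+ k.+1 / sqn R i.+1 ^+ k.+1) =
  - ((sqn R (nxt i) ^+ k.+1 * b - sqn R i.+1 ^+ k.+1 * a) / sqn R i.+1 ^+ k.+1) +
  (b - z) * (sqn R (nxt i) ^+ k.+1 / sqn R i.+1 ^+ k.+1) by field.
apply: le_trans (ler_normD _ _) _; rewrite normrN !normrM.
by rewrite normfV !(ger0_norm (exprn_ge0 _ (sqn_ge0 _))).
Qed.

Lemma nxt_ratio_cvg : (nxt i)%:R / i.+1%:R @[i --> \oo] --> (1 : R).
Proof.
have h : (nxt i - i.+1)%:R / i.+1%:R @[i --> \oo] --> (0 : R).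
  apply: (dominated_cvg0 _ nxt_sub_dominated) => // i.
  rewrite -[leRHS](kap_exp R p_gt0) -[16%N]/(12 + 4)%N exprD.
  rewrite ler_wpM2l ?exprn_ge0 ?kap_ge0 ?root16_ge0 //.
  apply: le_trans (@root16_le_kap i 1 p_gt0) _.
  by rewrite -[leLHS]expr1 ler_weXn2l // kap_ge1.
have h2 : 1 + (nxt i - i.+1)%:R / i.+1%:R @[i --> \oo] --> (1 + 0 : R).
  by apply: cvgD => //; exact: cvg_cst.
rewrite addr0 in h2; apply: cvg_trans h2; apply: near_eq_cvg; apply: nearW => i.
have [_ _ /ltnW le_n] := root4P i.
by rewrite /= natrB // mulrBl mulfV ?pnatr_eq0 // addrC subrK.
Qed.

Lemma sqn_ratio_cvg : sqn R (nxt i) / sqn R i.+1 @[i --> \oo] --> (1 : R).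
Proof.
(* The ratio is at least 1, so it lies between 1 and its own square. *)
apply: (@squeeze_cvgr _ _ _ _ (fun=> 1) (fun i => (nxt i)%:R / i.+1%:R)); [|exact: cvg_cst|exact: nxt_ratio_cvg]; apply: nearW => i.
have [_ _ /ltnW le_n] := root4P i.
have s0 := sqn_gt0 R (ltn0Sn i).
have q1 : 1 <= sqn R (nxt i) / sqn R i.+1.
  by rewrite ler_pdivlMr // mul1r ler_sqrt ?ler_nat.
rewrite q1 /= -(sqn_sqr R (nxt i)) -(sqn_sqr R i.+1) -expr_div_n.
by rewrite expr2 ler_peMr // (le_trans ler01).
Qed.

Lemma tr_Ymx_cvg k : (k < p)%N ->
  \tr (Ymx y i.+1 ^+ k.+1) / i.+1%:R @[i --> \oo] --> (ballot k.+1 0)%:R * c ^+ k.+1.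
Proof.
move=> kp.
pose z i := (ballot k.+1 0)%:R * c ^+ k.+1 * (nxt i)%:R * (sqn R (nxt i) / sqn R i.+1) ^+ k.+1.
have h : `|\tr (Ymx y i.+1 ^+ k.+1) - z i| / i.+1%:R @[i --> \oo] --> 0.
  apply: (dominated_cvg0 _ (tr_Xmx_estimate kp)) => // i.
  rewrite -[leRHS](kap_exp R p_gt0) -[16%N]/(13 + 3)%N exprD.
  rewrite ler_wpM2l ?exprn_ge0 ?kap_ge0 ?root16_ge0 //.
  apply: le_trans (@root16_le_kap i 1 p_gt0) _.
  by rewrite -[leLHS]expr1 ler_weXn2l // kap_ge1.
have hz : z i / i.+1%:R @[i --> \oo] --> (ballot k.+1 0)%:R * c ^+ k.+1.
  have : (ballot k.+1 0)%:R * c ^+ k.+1 * ((nxt i)%:R / i.+1%:R) *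
     (sqn R (nxt i) / sqn R i.+1) ^+ k.+1 @[i --> \oo] --> (ballot k.+1 0)%:R * c ^+ k.+1 * 1 * 1 ^+ k.+1.
    apply: cvgM; first by apply: cvgMr; exact: nxt_ratio_cvg.
    exact: (cvg_comp _ _ sqn_ratio_cvg (@exprn_continuous _ k.+1 1)).
  rewrite expr1n !mulr1; apply: cvg_trans; apply: near_eq_cvg; apply: nearW => i.
  by rewrite /z /=; ring.
have h' : (\tr (Ymx y i.+1 ^+ k.+1) - z i) / i.+1%:R @[i --> \oo] --> 0.
  apply/norm_cvg0P; apply: cvg_trans h; apply: near_eq_cvg; apply: nearW => i.
  by rewrite /= normrM normfV (ger0_norm (ler0n _ _)).
have h2 : (\tr (Ymx y i.+1 ^+ k.+1) - z i) / i.+1%:R + z i / i.+1%:R @[i --> \oo] -->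
    (0 + (ballot k.+1 0)%:R * c ^+ k.+1 : R) by exact: cvgD h' hz.
rewrite add0r in h2; apply: cvg_trans h2; apply: near_eq_cvg; apply: nearW => i.
by rewrite /= -mulrDl subrK.
Qed.

End Moments.

(** * Products of independent variables *)

Section WeightedLaw.
Import HBNNSimple.
Local Open Scope ereal_scope.
Context d (T : measurableType d) (R : realType) (P : probability T R)
  (L : probability (measurableTypeR R) R).
Variables (G : T -> R) (X : {RV P >-> measurableTypeR R}) (g : R).
Hypotheses (mG : measurable_fun [set: T] G) (G0 : forall t, (0 <= G t)%R).
Hypothesis g0 : (0 <= g)%R.
Hypothesis GX : forall B : set (measurableTypeR R), measurable B ->
  \int[P]_t (G t * \1_B (X t))%:E = g%:E * L B.

(** The hypothesis [GX] gives the identity on indicators; simple functions and monotone convergence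
    extend it to every non-negative [h]. *)
Lemma ge0_integral_weighted_law (h : measurableTypeR R -> R) :
  measurable_fun [set: measurableTypeR R] h -> (forall x, (0 <= h x)%R) ->
  \int[P]_t (G t * h (X t))%:E = g%:E * \int[L]_x (h x)%:E.
Proof.
move=> mh h0.
have mX : measurable_fun [set: T] X by [].
have mEh : measurable_fun [set: measurableTypeR R] (EFin \o h) by exact/measurable_EFinP.
pose f := nnsfun_approx measurableT mEh.
have mGf n : measurable_fun [set: T] (fun t => G t * f n (X t))%R.
  by apply: measurable_funM => //; exact: measurableT_comp.
have f_cvg x : (EFin \o f ^~ x) @ \oo --> (h x)%:E.
  by apply: (@cvg_nnsfun_approx _ _ _ _ measurableT _ mEh) => // y _; rewrite lee_fin.
have f_nd x : {homo (fun n => (f n x)%:E) : m n / (m <= n)%N >-> m <= n}.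
  by move=> m n mn; rewrite lee_fin; exact/lefP/nd_nnsfun_approx.
have -> : \int[L]_x (h x)%:E = limn (fun n => \int[L]_x (f n x)%:E).
  rewrite -monotone_convergence //.
  - by apply: eq_integral => x _; apply/esym/cvg_lim => //; exact: f_cvg.
  - by move=> n; exact/measurable_EFinP.
  - by move=> n x _; rewrite lee_fin.
have -> : \int[P]_t (G t * h (X t))%:E = limn (fun n => \int[P]_t (G t * f n (X t))%:E).
  rewrite -monotone_convergence //.
  - apply: eq_integral => t _; apply/esym/cvg_lim => //.
    rewrite EFinM; under eq_fun do rewrite EFinM.
    by apply: cvgeZl => //; exact: f_cvg.
  - by move=> n; exact/measurable_EFinP.
  - by move=> n x _; rewrite lee_fin mulr_ge0.
  - move=> t _ m n mn; rewrite lee_fin ler_wpM2l //.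
    by have := f_nd (X t) m n mn; rewrite lee_fin.
have -> : (fun n => \int[P]_t (G t * f n (X t))%:E) =
          (fun n => g%:E * \int[L]_x (f n x)%:E).
  apply/funext => n.
  rewrite [in RHS]integralT_nnsfun sintegralE.
  have fin : finite_set (range (f n)) by [].
  have r0 y : y \in range (f n) -> (0 <= y)%R by rewrite inE => -[x _ <-].
  transitivity (\int[P]_t (\sum_(y \in range (f n))
      (y%:E * (G t * \1_(f n @^-1` [set y]) (X t))%:E))).
    apply: eq_integral => t _.
    rewrite fimfunE EFinM -fsumEFin // ge0_mule_fsumr.
      by apply: eq_fsbigr => y _; rewrite EFinM muleCA -EFinM.
    by move=> y; rewrite nnfun_muleindic_ge0.
  have mfy y : measurable (f n @^-1` [set y]) by exact: measurable_funPTI.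
  have mI y : measurable_fun [set: measurableTypeR R] (\1_(f n @^-1` [set y]) : _ -> R).
    exact: measurable_indic.
  have mG1 y : measurable_fun [set: T] (fun t => G t * \1_(f n @^-1` [set y]) (X t))%R.
    apply: measurable_funM => //.
    exact: (measurableT_comp (mI y) mX).
  have y_ge0 y z : 0 <= y%:E * (\1_(f n @^-1` [set y]) z)%:E.
    exact: nnfun_muleindic_ge0.
  rewrite ge0_integral_fsum //; last 2 first.
    by move=> y; apply: measurable_funeM; exact/measurable_EFinP.
    by move=> y t _; rewrite EFinM muleCA mule_ge0 // lee_fin.
  rewrite ge0_mule_fsumr; last first.
    by move=> y; exact: nnsfun_mulemu_ge0.
  apply: eq_fsbigr => y /r0 y0.
  rewrite ge0_integralZl ?lee_fin //.
  - by rewrite GX // muleCA.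
  - exact/measurable_EFinP.
  - by move=> t _; rewrite lee_fin mulr_ge0.
apply: limeMl => //.
apply: ereal_nondecreasing_is_cvgn => m n mn.
apply: ge0_le_integral => //.
- by move=> x _; rewrite lee_fin.
- exact/measurable_EFinP.
- exact/measurable_EFinP.
- by move=> x _; exact: f_nd.
Qed.

End WeightedLaw.

Section HasMean.
Context d (T : measurableType d) (R : realType) (mu : {measure set T -> \bar R}).
Implicit Types (f g : T -> R) (a b c m : R).

(** Integrability is bundled with the value, so that real-valued linearity rules need no side
    conditions. *)
Definition has_mean f m :=
  mu.-integrable [set: T] (EFin \o f) /\ (\int[mu]_t (f t)%:E = m%:E)%E.

Lemma has_mean_uniq f a b : has_mean f a -> has_mean f b -> a = b.
Proof. by move=> [_ fa] [_]; rewrite fa => -[]. Qed.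

Lemma has_mean_measurable f a : has_mean f a -> measurable_fun [set: T] f.
Proof. by move=> [/measurable_int/measurable_EFinP]. Qed.

Lemma eq_has_mean f g a b : f =1 g -> a = b -> has_mean f a -> has_mean g b.
Proof. by move=> /funext -> ->. Qed.

Lemma integrable_has_mean f : mu.-integrable [set: T] (EFin \o f) ->
  has_mean f (fine (\int[mu]_t (f t)%:E)).
Proof.
by move=> h; split=> //; rewrite fineK //; exact: (integrable_fin_num _ h).
Qed.

Lemma has_meanD f g a b : has_mean f a -> has_mean g b ->
  has_mean (fun t => f t + g t) (a + b).
Proof.
move=> [fi fa] [gi gb]; split.
  by rewrite (_ : _ \o _ = (EFin \o f) \+ (EFin \o g))%E //; exact: integrableD.
under eq_integral do rewrite EFinD.
by rewrite (integralD_EFin measurableT fi gi) EFinD -fa -gb.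
Qed.

Lemma has_meanZ c f a : has_mean f a -> has_mean (fun t => c * f t) (c * a).
Proof.
move=> [fi fa]; split.
  by rewrite (_ : _ \o _ = fun t => c%:E * (f t)%:E)%E //; exact: integrableZl.
by under eq_integral do rewrite EFinM; rewrite integralZl // fa EFinM.
Qed.

Lemma has_meanB f g a b : has_mean f a -> has_mean g b ->
  has_mean (fun t => f t - g t) (a - b).
Proof.
move=> fa /(has_meanZ (-1)) gb; apply: eq_has_mean (has_meanD fa gb).
  by move=> t; rewrite mulN1r.
by rewrite mulN1r.
Qed.

Lemma has_mean0 : has_mean (fun=> 0) 0.
Proof. by split; [exact: integrable0 | rewrite integral0]. Qed.

Lemma has_mean_sum (I : Type) (r : seq I) (Q : pred I) (f : I -> T -> R) (m : I -> R) :
  (forall i, Q i -> has_mean (f i) (m i)) ->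
  has_mean (fun t => \sum_(i <- r | Q i) f i t) (\sum_(i <- r | Q i) m i).
Proof.
move=> H; elim: r => [|i r IH].
  by apply: eq_has_mean has_mean0 => [t|]; rewrite big_nil.
have [Qi|Qi] := boolP (Q i).
  apply: eq_has_mean (has_meanD (H i Qi) IH) => [t|];
    by rewrite big_cons Qi.
by apply: eq_has_mean IH => [t|]; rewrite big_cons (negPf Qi).
Qed.

Lemma has_mean_le f g a b : has_mean f a -> has_mean g b ->
  (forall t, f t <= g t) -> a <= b.
Proof.
move=> [fi fa] [gi gb] fg; rewrite -lee_fin -fa -gb.
by apply: le_integral => // t _; rewrite lee_fin.
Qed.

Lemma has_mean_norm f a : has_mean f a -> exists b, has_mean (fun t => `|f t|) b.
Proof.
by move=> [/integrable_norm fi _]; eexists; exact: integrable_has_mean fi.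
Qed.

Lemma has_mean_dominated f g b : measurable_fun [set: T] f -> has_mean g b ->
  (forall t, `|f t| <= g t) -> exists a, has_mean f a.
Proof.
move=> mf [gi _] fg; eexists; apply: integrable_has_mean.
apply: le_integrable gi => //; first exact/measurable_EFinP.
by move=> t _ /=; rewrite lee_fin (le_trans (fg t)) // ler_norm.
Qed.

Lemma ge0_has_mean f m : measurable_fun [set: T] f -> (forall t, 0 <= f t) ->
  (\int[mu]_t (f t)%:E = m%:E)%E -> has_mean f m.
Proof.
move=> mf f0 fm; split => //; apply/integrableP; split; first exact/measurable_EFinP.
under eq_integral do rewrite /= ger0_norm //.
by rewrite fm ltry.
Qed.

End HasMean.

Section WeightedMean.
Context d (T : measurableType d) (R : realType) (P : probability T R)
  (L : probability (measurableTypeR R) R).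
Variable X : {RV P >-> measurableTypeR R}.

(** The form in which independence is propagated: weighting by [G] multiplies the law [L] of [X] by
    a constant, which is then the mean of [G]. *)
Definition decoupled (G : T -> R) (g : R) :=
  forall B : set (measurableTypeR R), measurable B ->
    has_mean P (fun t => G t * \1_B (X t)) (g * fine (L B)).

Lemma decoupled_mean G g : decoupled G g -> has_mean P G g.
Proof.
move=> /(_ setT measurableT); apply: eq_has_mean => [t|].
  by rewrite indicT mulr1.
by rewrite probability_setT mulr1.
Qed.

Lemma decoupledB G g H h : decoupled G g -> decoupled H h ->
  decoupled (fun t => G t - H t) (g - h).
Proof.
move=> Gg Hh B mB; rewrite mulrBl; apply: eq_has_mean (has_meanB (Gg B mB) (Hh B mB)) => //.
by move=> t; rewrite mulrBl.
Qed.

Lemma ge0_decoupledM (G : T -> R) g (h : measurableTypeR R -> R) m :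
  (forall t, 0 <= G t) -> decoupled G g -> (forall x, 0 <= h x) -> has_mean L h m ->
  has_mean P (fun t => G t * h (X t)) (g * m).
Proof.
move=> G0 Gg h0 hm; have Gm := decoupled_mean Gg.
have mG := has_mean_measurable Gm; have mh := has_mean_measurable hm.
have g0 : 0 <= g by apply: (has_mean_le (has_mean0 P) Gm).
apply: ge0_has_mean.
- by apply: measurable_funM => //; exact: measurableT_comp.
- by move=> t; rewrite mulr_ge0.
rewrite (@ge0_integral_weighted_law _ _ _ P L G X g) //.
  by rewrite hm.2 EFinM.
by move=> B mB; rewrite (Gg B mB).2 EFinM fineK // fin_num_measure.
Qed.

(** Signs are removed by writing [G] as [|G|] minus [|G| - G], and [h] likewise: all four functions
    are non-negative. This is why [|G|] must be decoupled as well. *)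
Lemma decoupledM (G : T -> R) g g' (h : measurableTypeR R -> R) m :
  decoupled G g -> decoupled (fun t => `|G t|) g' -> has_mean L h m ->
  has_mean P (fun t => G t * h (X t)) (g * m).
Proof.
move=> Gg Gg' hm.
have ge0_case k c : (forall x, 0 <= k x) -> has_mean L k c ->
    has_mean P (fun t => G t * k (X t)) (g * c).
  move=> k0 kc.
  have := has_meanB (ge0_decoupledM (fun t => normr_ge0 (G t)) Gg' k0 kc)
    (@ge0_decoupledM (fun t => `|G t| - G t) (g' - g) k c _ (decoupledB Gg' Gg) k0 kc).
  move=> /(_ (fun t => _)) H; apply: eq_has_mean (H _) => [t||t].
  - by rewrite mulrBl opprB addrC subrK.
  - by rewrite mulrBl opprB addrC subrK.
  - by rewrite subr_ge0 ler_norm.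
have [m' hm'] := has_mean_norm hm.
have := has_meanB (ge0_case (fun x => `|h x|) m' (fun x => normr_ge0 (h x)) hm')
   (ge0_case (fun x => `|h x| - h x) (m' - m) _ (has_meanB hm' hm)).
move=> H; apply: eq_has_mean (H _) => [t||t].
- by rewrite mulrBr opprB addrC subrK.
- by rewrite mulrBr opprB addrC subrK.
- by rewrite subr_ge0 ler_norm.
Qed.

End WeightedMean.

Section IndependentProducts.
Context d (T : measurableType d) (R : realType) (P : probability T R)
  (L : probability (measurableTypeR R) R)
  (I : choiceType) (D : set I) (X : I -> {RV P >-> measurableTypeR R}).
Hypothesis X_indep : independent_RVs D X.
Hypothesis X_law : forall i, D i -> has_law L (X i).

Lemma indep_has_mean_indic (s : seq I) (B : I -> set (measurableTypeR R)) :
  uniq s -> (forall i, i \in s -> D i) -> (forall i, measurable (B i)) ->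
  has_mean P (fun t => \prod_(i <- s) \1_(B i) (X i t)) (\prod_(i <- s) fine (L (B i))).
Proof.
move=> us sD mB.
pose J : {fset I} := seq_fset tt s.
have Js : perm_eq J s by rewrite (perm_trans (seq_fset_perm _ _)) // undup_id.
pose A := \bigcap_(i in [set` J]) (X i @^-1` B i).
have mXB i : measurable (X i @^-1` B i) by exact: measurable_funPTI.
have mA : measurable A.
  by apply: fin_bigcap_measurable => // i _; exact: mXB.
have e t : \prod_(i <- s) \1_(B i) (X i t) = \1_A t :> R.
  rewrite [RHS]indicE.
  have [tA|tA] := boolP (t \in A).
    rewrite big_seq big1 // => i si; move: tA; rewrite inE => /(_ i) /=.
    by rewrite indicE (perm_mem Js) => /(_ si) tB; rewrite mem_set.
  move: tA; rewrite notin_setE /A /bigcap => /existsNP[i] /not_implyP[/= Ji nB].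
  rewrite (perm_mem Js) in Ji; rewrite (big_rem i Ji) /= indicE.
  by rewrite memNset // mul0r.
have mi : has_mean P (\1_A : T -> R) (fine (P A)).
  split; first exact: integrable_indic.
  by rewrite integral_indic // setIT fineK // fin_num_measure.
apply: eq_has_mean mi; first by move=> t; rewrite e.
rewrite /A X_indep; first last.
- by move=> i _; exact: mB.
- by move=> i /=; rewrite (perm_mem Js); exact: sD.
rewrite (perm_big s Js) /=.
have -> : (\prod_(i <- s) P (X i @^-1` B i) = \prod_(i <- s) (fine (L (B i)))%:E)%E.
  rewrite big_seq [RHS]big_seq; apply: eq_bigr => i si.
  by rewrite fineK ?fin_num_measure //; apply: X_law => //; exact: sD.
by rewrite prodEFin.
Qed.

(** Indicator factors are turned into general ones one at a time: with [e] moved to the list [r],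
    the induction hypothesis says that the other factors are decoupled from [X e], and [decoupledM]
    inserts [h e]. *)
Lemma indep_has_mean_prod_indic (s r : seq I) (h : I -> R -> R) (m : I -> R)
    (B : I -> set (measurableTypeR R)) :
  uniq (s ++ r) -> (forall i, i \in s ++ r -> D i) -> (forall i, measurable (B i)) ->
  (forall i, i \in s -> has_mean L (h i) (m i)) ->
  has_mean P (fun t => \prod_(i <- s) h i (X i t) * \prod_(i <- r) \1_(B i) (X i t))
    (\prod_(i <- s) m i * \prod_(i <- r) fine (L (B i))).
Proof.
elim: s r h m B => [|e s IH] r h m B /=.
  move=> ur rD mB _; apply: eq_has_mean (indep_has_mean_indic ur rD mB) => [t|];
    by rewrite big_nil mul1r.
move=> usr sD mB hm.
have perm_sr : perm_eq (s ++ e :: r) (e :: s ++ r).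
  by rewrite -cat1s perm_catCA.
(* Stated for arbitrary [k], since it is used for [h] and for its absolute values. *)
have step k c : (forall i, i \in s -> has_mean L (k i) (c i)) ->
    decoupled L (X e) (fun t => \prod_(i <- s) k i (X i t) * \prod_(i <- r) \1_(B i) (X i t))
    (\prod_(i <- s) c i * \prod_(i <- r) fine (L (B i))).
  move=> kc A mA.
  pose B' i := if i == e then A else B i.
  have B'e : B' e = A by rewrite /B' eqxx.
  have rB' i : i \in r -> B' i = B i.
    by rewrite /B'; case: eqVneq => // -> er; move: usr; rewrite mem_cat er orbT.
  apply: eq_has_mean (IH (e :: r) k c B' _ _ _ kc) => [t||||].
  - rewrite big_cons B'e mulrA mulrAC; congr (_ * _ * _).
    by rewrite big_seq [RHS]big_seq; apply: eq_bigr => i ir; rewrite rB'.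
  - rewrite big_cons B'e mulrA mulrAC; congr (_ * _ * _).
    by rewrite big_seq [RHS]big_seq; apply: eq_bigr => i ir; rewrite rB'.
  - by rewrite (perm_uniq perm_sr).
  - by move=> i; rewrite (perm_mem perm_sr); exact: sD.
  - by move=> i; rewrite /B'; case: ifP.
have hs i : i \in s -> has_mean L (h i) (m i) by move=> si; apply: hm; rewrite inE si orbT.
have hn i : i \in s -> has_mean L (fun x => `|h i x|) (fine (\int[L]_x (`|h i x|)%:E)).
  by move=> /hs[/integrable_norm ? _]; exact: integrable_has_mean.
have hn' := step _ _ hn.
have := decoupledM (step _ _ hs) _ (hm e (mem_head _ _)).
move=> /(_ (\prod_(i <- s) (fine (\int[L]_x (`|h i x|)%:E)) * \prod_(i <- r) fine (L (B i)))).
move=> H; apply: eq_has_mean (H _) => [t||].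
- by rewrite big_cons mulrC mulrA.
- by rewrite big_cons mulrC mulrA.
move=> A mA; apply: eq_has_mean (hn' A mA) => // t; congr (_ * _).
rewrite normrM normr_prod; congr (_ * _).
by rewrite ger0_norm // prodr_ge0.
Qed.

Lemma indep_has_mean_prod (s : seq I) (h : I -> R -> R) (m : I -> R) :
  uniq s -> (forall i, i \in s -> D i) ->
  (forall i, i \in s -> has_mean L (h i) (m i)) ->
  has_mean P (fun t => \prod_(i <- s) h i (X i t)) (\prod_(i <- s) m i).
Proof.
move=> us sD hm.
have := @indep_has_mean_prod_indic s [::] h m (fun=> setT); rewrite cats0.
move=> /(_ us sD (fun _ => measurableT) hm).
by apply: eq_has_mean => [t|]; rewrite big_nil mulr1.
Qed.

End IndependentProducts.

(** * Second moments of square-free polynomials *)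

Section Monomials.
Context d (T : measurableType d) (R : realType) (P : probability T R)
  (L : probability (measurableTypeR R) R)
  (I : choiceType) (D : set I) (X : I -> {RV P >-> measurableTypeR R}).
Hypothesis X_indep : independent_RVs D X.
Hypothesis X_law : forall i, D i -> has_law L (X i).
Variables (B : eqType) (g : B -> R -> R) (c : B -> B -> R) (kappa : R).
Hypothesis g_mean : forall b, has_mean L (g b) 0.
Hypothesis gg_mean : forall b b', has_mean L (fun x => g b x * g b' x) (c b b').
Hypothesis kappa_ge1 : 1 <= kappa.
Hypothesis c_le : forall b, c b b <= kappa.
Implicit Types F : seq (I * B).

Definition mono F t : R := \prod_(p <- F) g p.2 (X p.1 t).

(** Equal to 1 when [i] does not occur in [F], so that two monomials can be written as products over
    a common index list. *)
Definition mono_at F i x : R := \prod_(p <- F | p.1 == i) g p.2 x.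

Lemma mono_split F (J : seq I) t : uniq J -> {subset unzip1 F <= J} ->
  mono F t = \prod_(i <- J) mono_at F i (X i t).
Proof.
move=> uJ; elim: F => [|[i b] F IH] FJ.
  by rewrite /mono big_nil big1 // => i _; rewrite /mono_at big_nil.
rewrite /mono big_cons [X in _ * X]IH; last first.
  by move=> j jF; apply: FJ; rewrite inE jF orbT.
rewrite (big_rem i) /=; last by apply: FJ; rewrite mem_head.
rewrite [RHS](big_rem i) /=; last by apply: FJ; rewrite mem_head.
rewrite mulrA; congr (_ * _); first by rewrite /mono_at big_cons eqxx.
rewrite big_seq [RHS]big_seq; apply: eq_bigr => j.
rewrite mem_rem_uniq // inE => /andP[ji _].
by rewrite /mono_at big_cons /= eq_sym (negPf ji).
Qed.

Lemma mono_at_notin F i x : i \notin unzip1 F -> mono_at F i x = 1.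
Proof.
move=> iF; rewrite /mono_at big1_seq // => p /andP[/eqP pi pF].
by move: iF; rewrite -pi map_f.
Qed.

Lemma mono_at_in F i : uniq (unzip1 F) -> i \in unzip1 F ->
  exists b, mono_at F i =1 g b.
Proof.
elim: F => [//|[j b] F IH] /= /andP[jF uF]; rewrite inE => /predU1P[->|iF].
  by exists b => x; rewrite /mono_at big_cons eqxx [X in _ * X]mono_at_notin ?mulr1.
have [b' e] := IH uF iF; exists b' => x; rewrite -e /mono_at big_cons /=.
by have [ji|//] := eqVneq j i; move: jF; rewrite ji iF.
Qed.

Lemma has_mean_mono_atM F F' i : uniq (unzip1 F) -> uniq (unzip1 F') ->
  has_mean L (fun x => mono_at F i x * mono_at F' i x)
   (fine (\int[L]_x (mono_at F i x * mono_at F' i x)%:E)).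
Proof.
move=> uF uF'.
suff [m hm] : exists m, has_mean L (fun x => mono_at F i x * mono_at F' i x) m.
  exact: integrable_has_mean hm.1.
have [iF|iF] := boolP (i \in unzip1 F); have [iF'|iF'] := boolP (i \in unzip1 F').
- have [b e] := mono_at_in uF iF; have [b' e'] := mono_at_in uF' iF'.
  by exists (c b b'); apply: eq_has_mean (gg_mean b b') => // x; rewrite e e'.
- have [b e] := mono_at_in uF iF; exists 0; apply: eq_has_mean (g_mean b) => // x.
  by rewrite e mono_at_notin // mulr1.
- have [b e] := mono_at_in uF' iF'; exists 0; apply: eq_has_mean (g_mean b) => // x.
  by rewrite e mono_at_notin // mul1r.
- exists 1; have -> : (fun x => mono_at F i x * mono_at F' i x) = cst 1.
    by apply/funext => x; rewrite !mono_at_notin // mul1r.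
  split; first exact: finite_measure_integrable_cst.
  rewrite /= integral_cst // [X in (1 * X)%E](_ : _ = 1%E) ?mule1 //.
  exact: (probability_setT L).
Qed.

Lemma mono_mul_mean F F' : uniq (unzip1 F) -> uniq (unzip1 F') ->
  (forall i, i \in unzip1 F -> D i) -> (forall i, i \in unzip1 F' -> D i) ->
  has_mean P (fun t => mono F t * mono F' t)
   (\prod_(i <- undup (unzip1 F ++ unzip1 F'))
      fine (\int[L]_x (mono_at F i x * mono_at F' i x)%:E)).
Proof.
move=> uF uF' FD F'D.
set J := undup _.
apply: eq_has_mean (indep_has_mean_prod X_indep X_law (undup_uniq _) _
  (fun i _ => has_mean_mono_atM i uF uF')) => //.
- move=> t; rewrite big_split /= -!mono_split ?undup_uniq // => i iF;
    by rewrite mem_undup mem_cat iF ?orbT.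
- by move=> i; rewrite mem_undup mem_cat => /orP[]; [exact: FD | exact: F'D].
Qed.

(** The variable of index [i] enters through a single centred factor, which by independence
    annihilates the mean. *)
Lemma mono_mul_mean0 F F' i : uniq (unzip1 F) -> uniq (unzip1 F') ->
  (forall j, j \in unzip1 F -> D j) -> (forall j, j \in unzip1 F' -> D j) ->
  i \in unzip1 F -> i \notin unzip1 F' ->
  has_mean P (fun t => mono F t * mono F' t) 0.
Proof.
move=> uF uF' FD F'D iF iF'; apply: eq_has_mean (mono_mul_mean uF uF' FD F'D) => //.
rewrite (big_rem i) /=; last by rewrite mem_undup mem_cat iF.
have [b e] := mono_at_in uF iF.
rewrite [X in fine X](_ : _ = 0)%E ?mul0r //.
under eq_integral do rewrite e mono_at_notin // mulr1.
exact: (g_mean b).2.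
Qed.

Lemma mono_sqr_mean F : uniq (unzip1 F) -> (forall i, i \in unzip1 F -> D i) ->
  exists2 m, has_mean P (fun t => mono F t * mono F t) m & m <= kappa ^+ size F.
Proof.
move=> uF FD; eexists.
  apply: eq_has_mean (indep_has_mean_prod X_indep X_law uF FD
    (fun i _ => has_mean_mono_atM i uF uF)) => //.
  by move=> t; rewrite big_split /= -!mono_split.
have -> : kappa ^+ size F = \prod_(i <- unzip1 F) kappa.
  by rewrite big_const_seq count_predT size_map iter_mulr_1.
rewrite big_seq [leRHS]big_seq; apply: ler_prod => i iF.
have [b e] := mono_at_in uF iF.
have := @has_mean_mono_atM F F i uF uF.
set m := fine _ => hm.
have -> : m = c b b.
  apply: has_mean_uniq hm _; apply: eq_has_mean (gg_mean b b) => // x; by rewrite e.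
rewrite c_le andbT.
apply: has_mean_le (has_mean0 L) (gg_mean b b) _ => x.
by rewrite -expr2 sqr_ge0.
Qed.

Variables (V K : finType) (A : pred V) (F : V -> seq (I * B)) (key : V -> K).
Variables (deg M : nat).
Hypothesis F_uniq : forall v, A v -> uniq (unzip1 (F v)).
Hypothesis F_dom : forall v, A v -> forall i, i \in unzip1 (F v) -> D i.
Hypothesis F_size : forall v, A v -> (size (F v) <= deg)%N.
Hypothesis F_mult : forall v, A v ->
  (#|[pred v' | [&& A v', key v' == key v & perm_eq (unzip1 (F v')) (unzip1 (F v))]]| <= M)%N.

(** An index seen by only one monomial makes the mean vanish. Otherwise the indices agree, though
    the labels in [B] may differ, and half the sum of the two second moments bounds the mean of the
    product. *)
Lemma mono_pair_mean v v' : A v -> A v' ->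
  exists2 m, has_mean P (fun t => mono (F v) t * mono (F v') t) m &
    m <= (if perm_eq (unzip1 (F v')) (unzip1 (F v)) then kappa ^+ deg else 0).
Proof.
move=> Av Av'.
have [|nperm] := boolP (perm_eq _ _); last first.
  exists 0 => //.
  have [/allP s1|/allPn[i i1 i2]] := boolP (all (mem (unzip1 (F v'))) (unzip1 (F v))); last first.
    exact: (mono_mul_mean0 (F_uniq Av) (F_uniq Av') (F_dom Av) (F_dom Av') i1 i2).
  have [/allP s2|/allPn[i i1 i2]] := boolP (all (mem (unzip1 (F v))) (unzip1 (F v'))); last first.
    apply: eq_has_mean (mono_mul_mean0 (F_uniq Av') (F_uniq Av) (F_dom Av') (F_dom Av) i1 i2) => //.
    by move=> t; rewrite mulrC.
  case/negP: nperm; apply: uniq_perm; rewrite ?F_uniq // => i.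
  by apply/idP/idP; [exact: s2 | exact: s1].
move=> _.
have hm := mono_mul_mean (F_uniq Av) (F_uniq Av') (F_dom Av) (F_dom Av').
eexists; first exact: hm.
have [m1 h1 le1] := mono_sqr_mean (F_uniq Av) (F_dom Av).
have [m2 h2 le2] := mono_sqr_mean (F_uniq Av') (F_dom Av').
have leX w : A w -> kappa ^+ size (F w) <= kappa ^+ deg.
  by move=> Aw; rewrite ler_weXn2l ?F_size.
apply: (@le_trans _ _ (2^-1 * (m1 + m2))).
  apply: has_mean_le hm (has_meanZ 2^-1 (has_meanD h1 h2)) _ => t.
  rewrite -subr_ge0; set a := mono _ _; set b := mono _ _.
  have -> : 2^-1 * (a * a + b * b) - a * b = 2^-1 * (a - b) ^+ 2 by field.
  by rewrite mulr_ge0 ?sqr_ge0 ?invr_ge0.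
by have := leX _ Av; have := leX _ Av'; lra.
Qed.

(** After expansion, orthogonality leaves for each [v] at most [M] partners with the same key and
    the same indices. *)
Lemma mono_second_moment :
  exists2 m, has_mean P (fun t => \sum_k (\sum_(v | A v && (key v == k)) mono (F v) t) ^+ 2) m &
    m <= (M * #|A|)%:R * kappa ^+ deg.
Proof.
pose m v v' := fine (\int[P]_t (mono (F v) t * mono (F v') t)%:E).
have hm v v' : A v -> A v' ->
    has_mean P (fun t => mono (F v) t * mono (F v') t) (m v v').
  by move=> Av Av'; have [? [h _] _] := mono_pair_mean Av Av'; exact: integrable_has_mean h.
exists (\sum_(v | A v) \sum_(v' | A v' && (key v' == key v)) m v v').
  have : has_mean P (fun t => \sum_(v | A v) \sum_(v' | A v' && (key v' == key v))
    mono (F v) t * mono (F v') t)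
    (\sum_(v | A v) \sum_(v' | A v' && (key v' == key v)) m v v').
    apply: has_mean_sum => v Av; apply: has_mean_sum => v' /andP[Av' _].
    exact: hm.
  apply: eq_has_mean => // t.
  rewrite (partition_big key predT) //=; apply: eq_bigr => k _.
  rewrite expr2 mulr_suml; apply: eq_bigr => v /andP[_ /eqP <-].
  by rewrite mulr_sumr.
have k0 : 0 <= kappa ^+ deg by rewrite exprn_ge0 // (le_trans ler01).
have -> : (M * #|A|)%:R * kappa ^+ deg = \sum_(v | A v) (M%:R * kappa ^+ deg).
  by rewrite sumr_const natrM mulrAC mulr_natr.
apply: ler_sum => v Av.
apply: (@le_trans _ _ (\sum_(v' | [&& A v', key v' == key v & perm_eq (unzip1 (F v')) (unzip1 (F v))]) kappa ^+ deg)).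
  rewrite [leRHS]big_mkcond [leLHS]big_mkcond /=; apply: ler_sum => v' _.
  case: (boolP (A v')) => //= Av'; case: eqP => //= _.
  have [m' h' le'] := mono_pair_mean Av Av'.
  by rewrite (has_mean_uniq (hm _ _ Av Av') h').
by rewrite sumr_const -[leLHS]mulr_natl ler_wpM2r // ler_nat F_mult.
Qed.

End Monomials.

(** * Edges of words, and second moments of sums over words *)

Section Words.
Variable n : nat.
Implicit Types (i j a b : 'I_n) (s : seq 'I_n) (e : nat * nat).

(** The index of the array entry read by [weight] at [i.+1] and [j.+1]. *)
Definition edge i j : nat * nat := (minn i.+1 j.+1, maxn i.+1 j.+1).

Lemma edge_dom i j : [set p : nat * nat | (1 <= p.1 <= p.2)%N] (edge i j).
Proof. by rewrite /edge /=; lia. Qed.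

Lemma edge_inj2 i j a b : edge i j = edge a b -> (i = a /\ j = b) \/ (i = b /\ j = a).
Proof.
move=> [h1 h2]; have [e|e] : (i = a :> nat /\ j = b :> nat) \/ (i = b :> nat /\ j = a :> nat) by lia.
  by left; case: e => *; split; apply: val_inj.
by right; case: e => *; split; apply: val_inj.
Qed.

Lemma edge_inj i j k : edge i j = edge i k -> j = k.
Proof. by move=> /edge_inj2[[_ ->]|[-> ->]]. Qed.

Fixpoint path_edges i s : seq (nat * nat * bool) :=
  if s is j :: s' then (edge i j, false) :: path_edges j s' else [::].

Definition endpoints (es : seq (nat * nat)) : seq nat :=
  flatten [seq [:: e.1; e.2] | e <- es].

Lemma size_endpoints es : size (endpoints es) = (2 * size es)%N.
Proof. by rewrite /endpoints; elim: es => //= e es ->; lia. Qed.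

Lemma perm_endpoints es es' : perm_eq es es' -> endpoints es =i endpoints es'.
Proof.
move=> h x; apply/flatten_mapP/flatten_mapP => -[e eE xe]; exists e => //.
  by rewrite -(perm_mem h).
by rewrite (perm_mem h).
Qed.

Lemma endpoints_edge i j es : (i.+1 \in endpoints (edge i j :: es)) * (j.+1 \in endpoints (edge i j :: es)).
Proof.
by split; rewrite /endpoints /= !inE /minn /maxn; case: ltnP; rewrite !eqxx ?orbT.
Qed.

Lemma endpoints_cons e es x : x \in endpoints es -> x \in endpoints (e :: es).
Proof. by rewrite /endpoints /= !inE => ->; rewrite !orbT. Qed.

Lemma size_path_edges i s : size (path_edges i s) = size s.
Proof. by elim: s i => //= j s IH i; rewrite IH. Qed.

Lemma path_edges_dom i s e : e \in unzip1 (path_edges i s) ->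
  [set p : nat * nat | (1 <= p.1 <= p.2)%N] e.
Proof.
by elim: s i => //= j s IH i; rewrite inE => /predU1P[->|/IH//]; exact: edge_dom.
Qed.

Lemma path_edges_endpoints i s j : j \in s -> j.+1 \in endpoints (unzip1 (path_edges i s)).
Proof.
elim: s i => //= k s IH i; rewrite inE => /predU1P[->|js].
  by rewrite endpoints_edge.
by apply: endpoints_cons; exact: IH.
Qed.

Lemma notin_path_edges i s a b : a \notin i :: s -> edge a b \notin unzip1 (path_edges i s).
Proof.
elim: s i => //= j s IH i; rewrite !inE !negb_or => /and3P[ai aj as_].
rewrite IH ?inE ?negb_or ?aj // andbT.
apply/eqP => /edge_inj2[[h _]|[h _]]; first by rewrite h eqxx in ai.
by rewrite h eqxx in aj.
Qed.

Lemma edgeC i j : edge i j = edge j i.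
Proof. by rewrite /edge minnC maxnC. Qed.

Lemma uniq_path_edges i s : uniq (i :: s) -> uniq (unzip1 (path_edges i s)).
Proof.
elim: s i => // j s IH i; rewrite [uniq _]/= [path_edges _ _]/= => /andP[ij uj].
by rewrite /= IH // andbT; exact: notin_path_edges.
Qed.

(** The head [i] of [s] does not recur, so the edge from [a] to [i] can be repeated only by the edge
    leaving [i], and only if that one returns to [a]: this is the excluded backtracking. *)
Lemma uniq_cycle_edges a s : uniq s -> index a s != 1%N -> uniq (unzip1 (path_edges a s)).
Proof.
case: s => // i s us; rewrite /= uniq_path_edges // andbT.
case: s us => // j s /= /andP[ij us] ia; rewrite inE negb_or edgeC notin_path_edges ?andbT //.
apply/eqP => /edge_inj2[[_ aj]|[h _]]; last by move: ij; rewrite h mem_head.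
subst j; move: ia; rewrite eqxx.
by have [ia|//] := eqVneq i a; move: ij; rewrite ia mem_head.
Qed.

Definition pendant_edges a s : seq (nat * nat * bool) :=
  (edge a (head a s), true) :: path_edges a (behead s).

Lemma uniq_pendant_edges a i s : uniq (a :: i :: s) -> uniq (unzip1 (pendant_edges a (i :: s))).
Proof.
rewrite /pendant_edges /= inE negb_or => /and3P[/andP[ai as_] is_ us].
rewrite uniq_path_edges /= ?as_ // andbT edgeC notin_path_edges // inE negb_or is_.
by rewrite eq_sym ai.
Qed.

Definition star_edges a s : seq (nat * nat * bool) := [seq (edge a j, false) | j <- s].

Lemma uniq_star_edges a s : uniq s -> uniq (unzip1 (star_edges a s)).
Proof. by move=> us; rewrite /unzip1 -map_comp map_inj_uniq // => i j /edge_inj. Qed.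

Lemma star_edges_endpoints a s j : j \in s -> j.+1 \in endpoints (unzip1 (star_edges a s)).
Proof.
elim: s => //= k s IH; rewrite inE => /predU1P[->|js]; first by rewrite endpoints_edge.
by apply: endpoints_cons; exact: IH.
Qed.

Lemma card_tuple_subset p (W : seq nat) :
  (#|[pred s : p.-tuple 'I_n | all (fun j => j.+1 \in W) s]| <= size W ^ p)%N.
Proof.
rewrite -sum1_card.
elim: p => [|p IH].
  rewrite (big_tuple0 (fun s => all (fun j : 'I_n => j.+1 \in W) s) (fun=> 1%N)) //.
rewrite (big_tuple_cons p (fun s => all (fun j : 'I_n => j.+1 \in W) s) (fun=> 1%N)) /=.
have -> : (\sum_(i < n) \sum_(s : p.-tuple 'I_n | (i.+1 \in W) && all (fun j : 'I_n => j.+1 \in W) s) 1 =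
   \sum_(i < n | i.+1 \in W) \sum_(s : p.-tuple 'I_n | all (fun j : 'I_n => j.+1 \in W) s) 1)%N.
  rewrite [RHS]big_mkcond /=; apply: eq_bigr => i _.
  by case: (i.+1 \in W) => //=; rewrite big_pred0_eq.
rewrite sum_nat_const expnS leq_mul //.
rewrite cardE -(size_map (fun i : 'I_n => i.+1)); apply: uniq_leq_size.
  by rewrite map_inj_uniq ?enum_uniq // => i j [/val_inj].
by move=> x /mapP[i]; rewrite mem_enum => iW ->.
Qed.

End Words.

Section WordMoments.
Context d (T : measurableType d) (R : realType) (P : probability T R)
  (L : probability (measurableTypeR R) R)
  (U : nat -> nat -> {RV P >-> measurableTypeR R}).
Hypothesis U_iid : iid_triangular_array L U.
Variables (s2 kappa : R).

Definition gfun (b : bool) (x : R) : R := if b then (x - 1) ^+ 2 - s2 else x - 1.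

Variable c : bool -> bool -> R.
Hypothesis g_mean : forall b, has_mean L (gfun b) 0.
Hypothesis gg_mean : forall b b', has_mean L (fun x => gfun b x * gfun b' x) (c b b').
Hypothesis kappa_ge1 : 1 <= kappa.
Hypothesis c_le : forall b, c b b <= kappa.

Definition centered (t : T) (n : nat) (i j : 'I_n) : R :=
  weight (fun a b => U a b t) i.+1 j.+1 - 1.

Notation umono F t := (mono (fun p => U p.1 p.2) gfun F t).

Lemma pprod_mono t n (i : 'I_n) s : pprod (@centered t n) i s = umono (path_edges i s) t.
Proof.
elim: s i => [|j s IH] i; first by rewrite /mono big_nil.
by rewrite /mono big_cons /= IH.
Qed.

Lemma pendant_mono t n (a i : 'I_n) s :
  (centered t a (head a (i :: s)) ^+ 2 - s2) * pprod (@centered t n) a (behead (i :: s)) =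
  umono (pendant_edges a (i :: s)) t.
Proof. by rewrite /mono big_cons /= pprod_mono. Qed.

Lemma star_mono t n (a : 'I_n) s :
  \prod_(j <- s) centered t a j = umono (star_edges a s) t.
Proof. by rewrite /mono big_map. Qed.

Section WordFamily.
Variables (n p deg : nat) (A : 'I_n -> seq 'I_n -> bool)
  (F : 'I_n -> seq 'I_n -> seq (nat * nat * bool)) (key : 'I_n -> seq 'I_n -> 'I_n).
Hypothesis F_uniq : forall a (s : p.-tuple 'I_n), A a s -> uniq (unzip1 (F a s)).
Hypothesis F_dom : forall a (s : p.-tuple 'I_n), A a s -> forall e, e \in unzip1 (F a s) ->
  [set q : nat * nat | (1 <= q.1 <= q.2)%N] e.
Hypothesis F_size : forall a (s : p.-tuple 'I_n), A a s -> (size (F a s) <= deg)%N.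
Hypothesis F_cover : forall a (s : p.-tuple 'I_n), A a s ->
  forall j, j \in (s : seq _) -> j.+1 \in endpoints (unzip1 (F a s)).

(* Two words with the same first letter and the same edges have the same
   letters, so that the number of words orthogonality leaves is bounded. *)
Lemma word_second_moment :
  exists2 m, has_mean P (fun t => \sum_a \sum_j
     (\sum_(s : p.-tuple 'I_n | A a s && (key a s == j)) umono (F a s) t) ^+ 2) m &
   m <= ((2 * deg) ^ p * \sum_a #|[pred s : p.-tuple 'I_n | A a s]|)%:R * kappa ^+ deg.
Proof.
pose V : finType := ('I_n * p.-tuple 'I_n)%type.
have [|||||m hm le_m] := @mono_second_moment d T R P L _ _ (fun p : nat * nat => U p.1 p.2)
  U_iid.1 _ bool gfun c kappa g_mean gg_mean kappa_ge1 c_le V ('I_n * 'I_n)%type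
  (fun v : V => A v.1 v.2) (fun v => F v.1 v.2) (fun v => (v.1, key v.1 v.2)) deg ((2 * deg) ^ p)%N.
- by move=> e eD; apply: U_iid.2.
- by move=> v; exact: F_uniq.
- by move=> v Av e; exact: F_dom.
- by move=> v; exact: F_size.
- move=> [a s] /= As.
  (* A competing word has all its letters among the at most [2 * deg] endpoints of these edges. *)
  set W := endpoints (unzip1 (F a s)).
  have sW : (size W ^ p <= (2 * deg) ^ p)%N.
    by case: (p) => // q; rewrite leq_exp2r // size_endpoints size_map leq_mul2l /= F_size.
  apply: leq_trans sW; apply: leq_trans (@card_tuple_subset n p W).
  apply: leq_trans (leq_imset_card (fun s' : p.-tuple 'I_n => (a, s'))
    [pred s' : p.-tuple 'I_n | all (fun j : 'I_n => j.+1 \in W) s']).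
  apply: subset_leq_card; apply/fintype.subsetP => -[a' s'].
  rewrite !inE => /and3P[/= As' /eqP[e _] peq]; subst a'.
  apply/imsetP; exists s' => //; rewrite inE; apply/allP => j js.
  by rewrite /W -(perm_endpoints peq); exact: F_cover As' _ js.
exists m.
  apply: eq_has_mean hm => // t.
  rewrite pair_bigA /=; apply: eq_bigr => -[a j] _ /=; congr (_ ^+ 2).
  rewrite (reindex_onto (fun s : p.-tuple 'I_n => (a, s)) snd) /=.
    by apply: eq_bigl => s; rewrite eqxx andbT xpair_eqE eqxx.
  by move=> [a' s] /andP[_ /eqP[-> _]].
apply: le_trans le_m _; rewrite le_eqVlt; apply/orP; left; apply/eqP.
congr (_ %:R * _); congr (_ * _)%N.
rewrite -sum1_card; under [RHS]eq_bigr do rewrite -sum1_card.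
by rewrite pair_big_dep.
Qed.

End WordFamily.

Lemma path_mx_moment l : exists2 C, 0 <= C & forall n, exists2 m,
  has_mean P (fun t => frob (path_mx (@centered t n) l) ^+ 2) m & m <= C * n%:R ^+ l.+1.
Proof.
exists (((2 * l) ^ l)%:R * kappa ^+ l).
  by rewrite mulr_ge0 // exprn_ge0 // (le_trans ler01).
move=> n; have [||||m hm le_m] := @word_second_moment n l l (fun a s => uniq (a :: s))
   (fun a s => path_edges a s) (fun a s => last a s).
- by move=> a s; exact: uniq_path_edges.
- by move=> a s _ e; exact: path_edges_dom.
- by move=> a s _; rewrite size_path_edges size_tuple.
- by move=> a s _ j; exact: path_edges_endpoints.
exists m.
  apply: eq_has_mean hm => // t; rewrite frob_sqr.
  apply: eq_bigr => i _; apply: eq_bigr => j _; rewrite mxE; congr (_ ^+ 2).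
  by apply: eq_bigr => s _; rewrite pprod_mono.
apply: le_trans le_m _; rewrite natrM -!mulrA ler_wpM2l // mulrC.
rewrite ler_wpM2l ?exprn_ge0 ?(le_trans ler01) // -natrX ler_nat.
apply: (@leq_trans (\sum_(a < n) n ^ l)%N); last by rewrite sum_nat_const card_ord expnS.
apply: leq_sum => a _; apply: leq_trans (max_card _) _.
by rewrite card_tuple card_ord.
Qed.

(** The vertex [a] is one of the [l.+1] letters of [s], so there are at most [l.+1 * n ^ l.+1]
    words: closing a cycle saves a factor [n] over [path_mx l.+1]. *)
Lemma cycle_mx_moment l : exists2 C, 0 <= C & forall n, exists2 m,
  has_mean P (fun t => frob (cycle_mx (@centered t n) l) ^+ 2) m & m <= C * n%:R ^+ l.+1.
Proof.
exists (((2 * l.+1) ^ l.+1)%:R * (l.+1%:R * kappa ^+ l.+1)).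
  by rewrite !mulr_ge0 // exprn_ge0 // (le_trans ler01).
move=> n; have [||||m hm le_m] := @word_second_moment n l.+1 l.+1
   (fun a s => [&& uniq s, a \in s & index a s != 1%N])
   (fun a s => path_edges a s) (fun a s => last a s).
- by move=> a s /and3P[us _ ix]; exact: uniq_cycle_edges.
- by move=> a s _ e; exact: path_edges_dom.
- by move=> a s _; rewrite size_path_edges size_tuple.
- by move=> a s _ j; exact: path_edges_endpoints.
exists m.
  apply: eq_has_mean hm => // t; rewrite frob_sqr.
  apply: eq_bigr => i _; apply: eq_bigr => j _; rewrite mxE; congr (_ ^+ 2).
  by apply: eq_bigr => s _; rewrite pprod_mono.
apply: le_trans le_m _; rewrite natrM -!mulrA ler_wpM2l // mulrCA mulrC.
rewrite ler_wpM2l ?exprn_ge0 ?(le_trans ler01) // -natrX -natrM ler_nat.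
apply: (@leq_trans (\sum_(s : l.+1.-tuple 'I_n) l.+1)%N); last first.
  by rewrite sum_nat_const card_tuple card_ord mulnC.
apply: (@leq_trans (\sum_(a < n) \sum_(s : l.+1.-tuple 'I_n | a \in (s : seq _)) 1)%N).
  apply: leq_sum => a _; rewrite sum1_card; apply: subset_leq_card.
  by apply/fintype.subsetP => s /and3P[].
rewrite (exchange_big_dep predT) //=; apply: leq_sum => s _.
by rewrite sum1_card (leq_trans (card_size _)) // size_tuple.
Qed.

(** There are as many words as for [path_mx l.+1]; the smallness of this error comes from the extra
    [sqn] by which [Gmx] divides. *)
Lemma pendant_mx_moment l : exists2 C, 0 <= C & forall n, exists2 m,
  has_mean P (fun t => frob (pendant_mx (@centered t n) s2 l.+1) ^+ 2) m &
  m <= C * n%:R ^+ l.+2.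
Proof.
exists (((2 * l.+1) ^ l.+1)%:R * kappa ^+ l.+1).
  by rewrite mulr_ge0 // exprn_ge0 // (le_trans ler01).
move=> n; have [||||m hm le_m] := @word_second_moment n l.+1 l.+1 (fun a s => uniq (a :: s))
   (fun a s => pendant_edges a s) (fun a s => last a (behead s)).
- by move=> a s; case/tupleP: s => i s; exact: uniq_pendant_edges.
- move=> a s _ e; case/tupleP: s => i s; rewrite /pendant_edges /= inE => /predU1P[->|].
    exact: edge_dom.
  exact: path_edges_dom.
- by move=> a s _; case/tupleP: s => i s; rewrite /= size_path_edges size_tuple.
- move=> a s _ j; case/tupleP: s => i s; rewrite inE => /predU1P[->|js].
    by rewrite endpoints_edge.
  by apply: endpoints_cons; exact: path_edges_endpoints.
exists m.
  apply: eq_has_mean hm => // t; rewrite frob_sqr.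
  apply: eq_bigr => i _; apply: eq_bigr => j _; rewrite mxE; congr (_ ^+ 2).
  by apply: eq_bigr => s _; case/tupleP: s => k s; rewrite pendant_mono.
apply: le_trans le_m _; rewrite natrM -!mulrA ler_wpM2l // mulrC.
rewrite ler_wpM2l ?exprn_ge0 ?(le_trans ler01) // -natrX ler_nat.
apply: (@leq_trans (\sum_(a < n) n ^ l.+1)%N); last by rewrite sum_nat_const card_ord -expnS.
apply: leq_sum => a _; apply: leq_trans (max_card _) _.
by rewrite card_tuple card_ord.
Qed.

(** The off-diagonal part of the square of a row sum. Being square-free it falls under the
    orthogonality argument, and its second moment stands in for the fourth moment of the row sum. *)
Definition row_pairs n (x : 'I_n -> 'I_n -> R) (a : 'I_n) : R :=
  \sum_(s : 2.-tuple 'I_n | uniq s) \prod_(j <- s) x a j.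

Lemma row_pairs_moment : exists2 C, 0 <= C & forall n, exists2 m,
  has_mean P (fun t => \sum_(a < n) row_pairs (@centered t n) a ^+ 2) m &
  m <= C * n%:R ^+ 3.
Proof.
exists (((2 * 2) ^ 2)%:R * kappa ^+ 2).
  by rewrite mulr_ge0 // exprn_ge0 // (le_trans ler01).
move=> n; have [||||m hm le_m] := @word_second_moment n 2 2 (fun a s => uniq s)
   (fun a s => star_edges a s) (fun a s => a).
- by move=> a s; exact: uniq_star_edges.
- by move=> a s _ e; rewrite /unzip1 -map_comp => /mapP[j _ ->]; exact: edge_dom.
- by move=> a s _; rewrite size_map size_tuple.
- by move=> a s _ j; exact: star_edges_endpoints.
exists m.
  apply: eq_has_mean hm => // t; apply: eq_bigr => i _.
  rewrite (bigD1 i) //= [X in _ + X]big1 ?addr0.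
    congr (_ ^+ 2); apply: eq_big => [s|s _]; first by rewrite eqxx andbT.
    by rewrite star_mono.
  by move=> j ji; rewrite big_pred0 ?expr0n // => s; rewrite eq_sym (negPf ji) andbF.
apply: le_trans le_m _; rewrite natrM -[leLHS]mulrA -[leRHS]mulrA ler_wpM2l // mulrC.
rewrite ler_wpM2l ?exprn_ge0 ?(le_trans ler01) // -natrX ler_nat.
apply: (@leq_trans (\sum_(a < n) n ^ 2)%N); last by rewrite sum_nat_const card_ord -expnS.
apply: leq_sum => a _; apply: leq_trans (max_card _) _.
by rewrite card_tuple card_ord.
Qed.

End WordMoments.

(** * Almost sure bounds from bounded means, and moments of the law *)

Section AlmostSurePowers.
Context d (T : measurableType d) (R : realType) (P : probability T R).

(** By telescoping, the sum of [N] terms is at most [2 - 1 / N] for [N > 0]. *)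
Lemma sum_inv_sqr_le (N : nat) : \sum_(m < N) (m.+1%:R ^+ 2)^-1 <= 2 :> R.
Proof.
case: N => [|N]; first by rewrite big_ord0.
suff : \sum_(m < N.+1) (m.+1%:R ^+ 2)^-1 <= 2 - N.+1%:R^-1 :> R.
  by move=> /le_trans; apply; rewrite gerBl invr_ge0.
elim: N => [|N IH]; first by rewrite big_ord1 expr1n invr1; lra.
rewrite big_ord_recr /=; apply: le_trans (lerD IH (lexx _)) _.
have -> : N.+2%:R = N.+1%:R + 1 :> R by rewrite -natr1.
have : 0 < N.+1%:R :> R by rewrite ltr0n.
move: (N.+1%:R : R) => y y0.
have -> : 2 - y^-1 + ((y + 1) ^+ 2)^-1 = 2 - (y + 1)^-1 - (y * (y + 1) ^+ 2)^-1.
  by field; rewrite !gt_eqF //; lra.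
by rewrite gerBl invr_ge0 mulr_ge0 ?sqr_ge0 // ltW.
Qed.

(** The series of [Z (m.+1 ^ q) / m.+1 ^ 2] has finite mean, hence is almost surely finite. Its sum
    serves as [K], since each non-negative term is at most the sum. *)
Lemma ae_power_bound (Z : nat -> T -> R) (C : R) (q : nat) :
  (forall n t, 0 <= Z n t) -> (forall n, exists2 m, has_mean P (Z n) m & m <= C) ->
  {ae P, forall t, exists2 K, 0 <= K & forall m, Z (m.+1 ^ q)%N t <= K * m.+1%:R ^+ 2}.
Proof.
move=> Z0 HZ.
pose f m t : \bar R := (((m.+1%:R ^+ 2)^-1 * Z (m.+1 ^ q)%N t)%:E)%E.
have f0 m t : (0 <= f m t)%E by rewrite lee_fin mulr_ge0 // invr_ge0 exprn_ge0.
have mf m : measurable_fun [set: T] (f m).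
  have [a /has_mean_measurable mZ _] := HZ (m.+1 ^ q)%N.
  by apply/measurable_EFinP; exact: measurable_funM.
have le_int m : (\int[P]_t f m t <= (C * (m.+1%:R ^+ 2)^-1)%:E)%E.
  have [a hZ aC] := HZ (m.+1 ^ q)%N.
  have [_ ->] := has_meanZ (m.+1%:R ^+ 2)^-1 hZ.
  by rewrite lee_fin mulrC ler_wpM2r // invr_ge0 exprn_ge0.
have C0 : 0 <= C.
  have [a hZ aC] := HZ 0%N; apply: le_trans aC.
  exact: has_mean_le (has_mean0 P) hZ (Z0 0%N).
have int_sum : (\int[P]_t (\sum_(m <oo) f m t) <= (C * 2)%:E)%E.
  rewrite integral_nneseries //.
  apply: lime_le.
    by apply: is_cvg_nneseries => m _ _; exact: integral_ge0.
  apply: nearW => N; rewrite big_mkord.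
  apply: (@le_trans _ _ (\sum_(m < N) (C * (m.+1%:R ^+ 2)^-1)%:E)%E).
    by apply: lee_sum => m _; exact: le_int.
  by rewrite sumEFin lee_fin -mulr_sumr ler_wpM2l // sum_inv_sqr_le.
have sum_int : P.-integrable [set: T] (fun t => (\sum_(m <oo) f m t)%E).
  apply/integrableP; split; first exact: ge0_emeasurable_sum.
  under eq_integral do rewrite gee0_abs ?nneseries_ge0 //.
  by rewrite (le_lt_trans int_sum) // ltry.
have := integrable_ae measurableT sum_int.
apply: filterS => t /(_ I) fin.
have S0 : (0 <= \sum_(m <oo) f m t)%E by apply: nneseries_ge0.
exists (fine (\sum_(m <oo) f m t)%E); first exact: fine_ge0.
move=> m; have : (f m t <= (fine (\sum_(m <oo) f m t)%E)%:E)%E.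
  rewrite fineK //; apply: le_trans (nneseries_lim_ge m.+1 _) => //.
  by rewrite big_nat_recr //= leeDr // sume_ge0.
by rewrite lee_fin mulrC ler_pdivrMr // exprn_gt0.
Qed.

End AlmostSurePowers.

Section LawMoments.
Context (R : realType) (L : probability (measurableTypeR R) R).
Hypothesis L_mean : law_mean L = 1%E.
Hypothesis L_moment4 : (\int[L]_x (x ^+ 4)%:E < +oo)%E.

Lemma law_mean_dominated (h : R -> R) K : measurable_fun [set: R] h ->
  (forall x, `|h x| <= K * (1 + x ^+ 4)) -> exists m, has_mean L h m.
Proof.
move=> mh hK.
have m4 : has_mean L (fun x => x ^+ 4) (fine (\int[L]_x (x ^+ 4)%:E)).
  apply: ge0_has_mean => [|x|].
  - exact: exprn_measurable.
  - by rewrite -[4%N]/(2 * 2)%N exprM sqr_ge0.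
  - rewrite fineK // ge0_fin_numE // integral_ge0 // => x _.
    by rewrite lee_fin -[4%N]/(2 * 2)%N exprM sqr_ge0.
have m0 : has_mean L (cst 1) 1.
  split; first exact: finite_measure_integrable_cst.
  by rewrite /= integral_cst // [X in (1 * X)%E](_ : _ = 1%E) ?mule1 //; exact: (probability_setT L).
have := @has_mean_dominated _ _ _ L h _ _ mh (has_meanZ K (has_meanD m0 m4)). by apply => x; exact: hK.
Qed.

Lemma gfun_measurable (s2 : R) b : measurable_fun [set: R] (gfun s2 b).
Proof.
have m1 : measurable_fun [set: R] (fun x : R => x - 1) by exact: measurable_funB.
by case: b => //=; apply: measurable_funB => //; exact: measurable_funX.
Qed.

Lemma normr_gfun_le (s2 : R) b x : `|gfun s2 b x| <= (2 + `|s2|) * (1 + x ^+ 2).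
Proof.
have s0 := normr_ge0 s2; have s1 := ler_norm s2; have s1' := ler_norm (- s2).
rewrite normrN in s1'; move: `|s2| s0 s1 s1' => a a0 s1 s1'.
have e1 : (x - 1) ^+ 2 = x ^+ 2 - x *+ 2 + 1 by ring.
have e2 : (x + 1) ^+ 2 = x ^+ 2 + x *+ 2 + 1 by ring.
have := sqr_ge0 (x - 1); have := sqr_ge0 (x + 1); have := sqr_ge0 x.
rewrite /gfun e1 e2; move: (x ^+ 2) => z z0 h1 h2.
have az := mulr_ge0 a0 z0; rewrite mulrDl !mulrDr !mulr1.
by case: b; rewrite ler_norml; apply/andP; split; lra.
Qed.

Lemma gfun_moments : exists c : bool -> bool -> R, exists kappa,
  [/\ forall b, has_mean L (gfun (law_sigma L ^+ 2) b) 0,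
      forall b b', has_mean L (fun x => gfun (law_sigma L ^+ 2) b x * gfun (law_sigma L ^+ 2) b' x) (c b b'),
      1 <= kappa & forall b, c b b <= kappa].
Proof.
have gg (s2 : R) b b' : has_mean L (fun x => gfun s2 b x * gfun s2 b' x)
    (fine (\int[L]_x (gfun s2 b x * gfun s2 b' x)%:E)).
  have [||m [i _]] := @law_mean_dominated (fun x => gfun s2 b x * gfun s2 b' x)
      ((2 + `|s2|) ^+ 2 * 2).
  - by apply: measurable_funM; exact: gfun_measurable.
  - move=> x; rewrite normrM.
    apply: le_trans (ler_pM _ _ (normr_gfun_le s2 b x) (normr_gfun_le s2 b' x)) _ => //.
    have -> : x ^+ 4 = (x ^+ 2) ^+ 2 by rewrite -exprM.
    move: (2 + _) (x ^+ 2) => k z; rewrite -subr_ge0.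
    (* With [z = x ^ 2], the gap between [2 * (1 + z ^ 2)] and [(1 + z) ^ 2] is [(1 - z) ^ 2]; hence
       the constant 2. *)
    rewrite (_ : _ - _ = (k * (1 - z)) ^+ 2) ?sqr_ge0 //; ring.
  exact: integrable_has_mean i.
have m1 : has_mean L (fun x : R => x) 1.
  have [||m [i _]] := @law_mean_dominated (fun x => x) 1.
  - exact: measurable_id.
  - move=> x; have -> : x ^+ 4 = (x ^+ 2) ^+ 2 by rewrite -exprM.
    rewrite mul1r ler_norml; have := sqr_ge0 (x ^+ 2 - 1); have := sqr_ge0 (x - 1).
    have := sqr_ge0 (x + 1) => h1 h2 h3; apply/andP; split; nra.
  by split => //; exact: L_mean.
have m0 : has_mean L (cst 1) 1.
  split; first exact: finite_measure_integrable_cst.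
  by rewrite /= integral_cst // [X in (1 * X)%E](_ : _ = 1%E) ?mule1 //; exact: (probability_setT L).
have g0 (s2 : R) : has_mean L (gfun s2 false) 0.
  by apply: eq_has_mean (has_meanB m1 m0) => //; rewrite subrr.
have var : has_mean L (fun x => (x - 1) ^+ 2) (law_sigma L ^+ 2).
  apply: eq_has_mean (gg 0 false false) => [x|]; first by rewrite expr2.
  rewrite /law_sigma sqr_sqrtr; last first.
    by apply: fine_ge0; apply: integral_ge0 => x _; rewrite lee_fin sqr_ge0.
  by congr fine; apply: eq_integral => x _; rewrite expr2.
pose c b b' := fine (\int[L]_x (gfun (law_sigma L ^+ 2) b x * gfun (law_sigma L ^+ 2) b' x)%:E).
exists c; exists (1 + (`|c true true| + `|c false false|)); split => //.
- case => //; apply: eq_has_mean (has_meanB var (has_meanZ (law_sigma L ^+ 2) m0)) => [x|].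
    by rewrite /= mulr1.
  by rewrite mulr1 subrr.
- by rewrite lerDl addr_ge0.
- move=> b; have := ler_norm (c b b).
  have := normr_ge0 (c true true); have := normr_ge0 (c false false).
  by case: b; lra.
Qed.

End LawMoments.

(** * From the weights to the kernel *)

Section RowSums.
Variables (R : realType) (y : nat -> nat -> R) (c : R).
Hypothesis y_sym : forall i j, y i j = y j i.
Hypothesis path_growth : forall q l,
  growth q (fun n => frob (path_mx (@trunc R y n) l) ^+ 2) l.+1.
Hypothesis cycle_growth : forall q l,
  growth q (fun n => frob (cycle_mx (@trunc R y n) l) ^+ 2) l.+1.
Hypothesis pendant_growth : forall q l,
  growth q (fun n => frob (pendant_mx (@trunc R y n) (c ^+ 2) l.+1) ^+ 2) l.+2.
Hypothesis row_growth : forall q,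
  growth q (fun n => \sum_(a < n) row_pairs (@trunc R y n) a ^+ 2) 3.
Variable p : nat.
Hypothesis p_gt0 : (0 < p)%N.

Definition rowsum n : 'cV[R]_n := Xmx y n *m const_mx 1.

Lemma rowsumE n a : rowsum n a 0 = \sum_(j < n) y a j.
Proof. by rewrite mxE; apply: eq_bigr => j _; rewrite !mxE mulr1. Qed.

Lemma rowsum_sqr n (a : 'I_n) : (\sum_(j < n) y a j) ^+ 2 =
  \sum_(j < n) y a j ^+ 2 + row_pairs (@trunc R y n) a.
Proof.
rewrite /row_pairs (big_tuple_cons 1 (fun s => uniq s) (fun s => \prod_(j <- s) trunc y a j)).
rewrite -big_split expr2 mulr_suml /=; apply: eq_bigr => j _.
rewrite (big_tuple_cons 0 (fun s => uniq (j :: s)) (fun s => \prod_(k <- j :: s) trunc y a k)).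
rewrite mulr_sumr (bigD1 j) //= -expr2; congr (_ + _).
rewrite big_mkcond /=; apply: eq_bigr => k _.
rewrite (big_tuple0 (fun s => uniq [:: j, k & s]) (fun s => \prod_(k <- [:: j, k & s]) trunc y a k)) /=.
by rewrite inE eq_sym; case: eqP => //= _; rewrite !big_cons big_nil mulr1.
Qed.

(** At size [N = nxt i] the squared row sum splits into a diagonal part, bounded by the operator
    norm, and [row_pairs]. The row of length [i.+1] is the long row minus its tail. *)
Lemma rowsum_bound : exists2 C, 0 <= C & forall i (a : 'I_i.+1),
  `|rowsum i.+1 a 0| <= C * kap R p i.+1 ^+ 15.
Proof.
have [C C0 Xop] := Xmx_nxt_opb y_sym path_growth cycle_growth pendant_growth p_gt0.
have [K K0 HK] := row_growth 4.
have [D D0 HD] := nxt_sub_dominated R p_gt0.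
have [M M0 HM] := root4S_dominated R p_gt0.
pose E := C ^+ 2 + Num.sqrt (K * M ^+ 2 * 16 ^+ 3).
exists (Num.sqrt E + Num.sqrt (D * C ^+ 2)) => [|i a]; first by rewrite addr_ge0 ?sqrtr_ge0.
have k0 := kap_ge0 R p i.+1; have k1 := kap_ge1 R p (ltn0Sn i).
have t1 := root16_ge1 R p (ltn0Sn i); have t0 := root16_ge0 R p i.+1.
have tk : root16 R p i.+1 <= kap R p i.+1 by have := @root16_le_kap R p i 1 p_gt0.
move: HK HD HM => /(_ (root4 i)) HK /(_ i) HD /(_ i) HM.
have [_ _ /ltnW le_n] := root4P i.
rewrite -/(nxt i) in HK; set N := nxt i in HK HD le_n.
have NE : N%:R <= 16 * kap R p i.+1 ^+ 16 :> R.
  by rewrite kap_exp // -[leRHS]natrM ler_nat; have := nxt_le i; rewrite -/N; lia.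
pose a' : 'I_N := widen_ord le_n a.
have row_sq : \sum_(j < N) y a j ^+ 2 <= C ^+ 2 * kap R p i.+1 ^+ 18.
  have XT : opb (Xmx y N)^T (C * (root16 R p i.+1 * sqn R i.+1)).
    by rewrite Xmx_tr //; exact: Xop.
  have := opb_row_le a' XT.
  under eq_bigr do rewrite !mxE /trunc /=.
  move=> /le_trans; apply; rewrite !exprMn ler_wpM2l ?sqr_ge0 // (@sqn_kap R p) // -exprM.
  rewrite -[18%N]/(2 + 16)%N exprD ler_wpM2r ?exprn_ge0 //.
  by apply: lerXn2r; rewrite ?nnegrE.
(* A single row is bounded by the sum over all rows: [m ^ 2 * N ^ 3] is of order
   [kap ^ 8 * kap ^ 48], the square of [kap ^ 28]. *)
have pairs_le : `|row_pairs (@trunc R y N) a'| <= Num.sqrt (K * M ^+ 2 * 16 ^+ 3) * kap R p i.+1 ^+ 28.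
  rewrite -(@ler_pXn2r _ 2) ?nnegrE ?mulr_ge0 ?sqrtr_ge0 ?exprn_ge0 //.
  rewrite exprMn sqr_sqrtr ?mulr_ge0 ?exprn_ge0 // real_normK ?num_real //.
  apply: (@le_trans _ _ (\sum_(b < N) row_pairs (@trunc R y N) b ^+ 2)).
    by rewrite (bigD1 a') //= lerDl sumr_ge0 // => b _; exact: sqr_ge0.
  apply: le_trans HK _; rewrite -[leLHS]mulrA.
  rewrite [leRHS](_ : _ = K * ((M * kap R p i.+1 ^+ 4) ^+ 2 * (16 * kap R p i.+1 ^+ 16) ^+ 3)); last by ring.
  rewrite ler_wpM2l //; apply: ler_pM; rewrite ?(exprn_ge0, ler0n) //;
    by apply: lerXn2r; rewrite ?nnegrE ?mulr_ge0 ?exprn_ge0.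
have full : `|\sum_(j < N) y a j| <= Num.sqrt E * kap R p i.+1 ^+ 15.
  rewrite -(@ler_pXn2r _ 2) ?nnegrE ?mulr_ge0 ?sqrtr_ge0 ?exprn_ge0 //.
  rewrite exprMn sqr_sqrtr ?addr_ge0 ?sqrtr_ge0 ?sqr_ge0 // real_normK ?num_real //.
  rewrite (rowsum_sqr a') mulrDl -exprM; apply: lerD.
    apply: le_trans row_sq _; rewrite ler_wpM2l ?sqr_ge0 // ler_weXn2l //.
  apply: le_trans (ler_norm _) _; apply: le_trans pairs_le _.
  by rewrite ler_wpM2l ?sqrtr_ge0 // ler_weXn2l.
(* Cauchy-Schwarz against the indicator of the removed columns: [kap ^ 18 * kap ^ 12] is the square
   of [kap ^ 15]. The tail dictates the exponent; the full row only needs 14. *)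
have tail : `|\sum_(j < N) y a j * (i.+1 <= j)%N%:R| <= Num.sqrt (D * C ^+ 2) * kap R p i.+1 ^+ 15.
  rewrite -(@ler_pXn2r _ 2) ?nnegrE ?mulr_ge0 ?sqrtr_ge0 ?exprn_ge0 //.
  rewrite exprMn sqr_sqrtr ?mulr_ge0 ?sqr_ge0 // real_normK ?num_real //.
  apply: le_trans (sum_cauchy_schwarz _ _) _.
  rewrite [leRHS](_ : _ = (C ^+ 2 * kap R p i.+1 ^+ 18) * (D * kap R p i.+1 ^+ 12)); last by ring.
  apply: ler_pM => //; try by apply: sumr_ge0 => *; exact: sqr_ge0.
  apply: le_trans HD; rewrite le_eqVlt; apply/orP; left; apply/eqP.
  under eq_bigr do rewrite -natrX.
  rewrite -natr_sum; congr (_ %:R).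
  transitivity (\sum_(0 <= j < N) (i < j) ^ 2)%N; first by rewrite big_mkord.
  rewrite (@big_cat_nat _ _ _ i.+1) //= big1_seq ?add0n; last first.
    by move=> j /andP[_]; rewrite mem_index_iota => /andP[_]; rewrite ltnS leqNgt => /negPf ->.
  rewrite (@eq_big_nat _ _ _ _ _ _ (fun=> 1%N)); first by rewrite sum_nat_const_nat muln1.
  by move=> j /andP[-> _].
rewrite rowsumE.
have -> : \sum_(j < i.+1) y a j = \sum_(j < N) y a j - \sum_(j < N) y a j * (i.+1 <= j)%N%:R.
  rewrite -sumrB (big_ord_widen N (fun j => y a j) le_n) big_mkcond /=.
  apply: eq_bigr => j _; rewrite [(j < i.+1)%N]ltnNge.
  by case: (i < j)%N; rewrite /= ?mulr1 ?mulr0 ?subrr ?subr0.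
by rewrite mulrDl; apply: le_trans (ler_normB _ _) (lerD full tail).
Qed.

End RowSums.

Section NuclearBound.
Variable R : realType.

(* A bound on the trace norm, by duality with the operator norm. *)
Definition nucb n (F : 'M[R]_n) tau :=
  forall Q q, 0 <= q -> opb Q q -> `|\tr (F *m Q)| <= tau * q.

(** Tested on the rank-one matrix [v *m (F *m v)^T], the trace is the square of [frob (F *m v)]. *)
Lemma nucb_opb n (F : 'M[R]_n) tau : 0 <= tau -> nucb F tau -> opb F tau.
Proof.
move=> tau0 Ft v.
have h : frob (F *m v) ^+ 2 <= tau * frob v * frob (F *m v).
  have -> : frob (F *m v) ^+ 2 = \tr (F *m (v *m (F *m v)^T)).
    rewrite mulmxA /mxtrace frob_sqr; apply: eq_bigr => i _.
    by rewrite [RHS]mxE; apply: eq_bigr => j _; rewrite [X in _ = _ * X]mxE expr2.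
  apply: le_trans (ler_norm _) _.
  apply: le_trans (Ft _ (frob v * frob (F *m v)) _ (opb_rank1 _ _)) _.
    by rewrite mulr_ge0 ?frob_ge0.
  by rewrite mulrA.
have := frob_ge0 (F *m v); rewrite le_eqVlt => /predU1P[<-|f0].
  by rewrite mulr_ge0 ?frob_ge0.
by move: h; rewrite expr2 ler_pM2r.
Qed.

Lemma nucb_rank1 n (u w : 'cV[R]_n) : nucb (u *m w^T) (frob u * frob w).
Proof. by move=> Q q q0 Qq; apply: le_trans (opb_trmx_mul_le u w Qq) _; rewrite -mulrA mulrC. Qed.

Lemma nucbD n (F G : 'M[R]_n) a b : nucb F a -> nucb G b -> nucb (F + G) (a + b).
Proof.
move=> Fa Gb Q q q0 Qq; rewrite mulmxDl linearD mulrDl.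
by apply: le_trans (ler_normD _ _) (lerD (Fa _ _ q0 Qq) (Gb _ _ q0 Qq)).
Qed.

Lemma nucbZ n (F : 'M[R]_n) a t : nucb F a -> nucb (t *: F) (`|t| * a).
Proof.
move=> Fa Q q q0 Qq; rewrite -scalemxAl linearZ normrM -mulrA ler_wpM2l //.
exact: Fa.
Qed.

Lemma nucb_le n (F : 'M[R]_n) a b : a <= b -> nucb F a -> nucb F b.
Proof. by move=> ab Fa Q q q0 Qq; apply: le_trans (Fa _ _ q0 Qq) _; rewrite ler_wpM2r. Qed.

Lemma nucb_diag_mul n (d : 'rV[R]_n) (G : 'M[R]_n) a g : 0 <= g -> (forall i, `|d 0 i| <= a) ->
  opb G g -> nucb (diag_mx d *m G) (n%:R * a * g).
Proof.
move=> g0 da Gg Q q q0 Qq; rewrite -mulmxA.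
apply: le_trans (opb_tr_diag_mul_le _ (opbM g0 Gg Qq)) _.
rewrite -[leRHS]mulrA ler_wpM2r ?mulr_ge0 //.
apply: (@le_trans _ _ (\sum_(i < n) a)); first exact: ler_sum.
by rewrite sumr_const card_ord mulr_natl.
Qed.

End NuclearBound.

(** * The kernel, its invariant law and its fluctuations *)

Section Kernel.
Variables (R : realType) (u : nat -> nat -> R) (n : nat).
Hypothesis rho_gt0 : forall i : 'I_n, 0 < rho u i.
Hypothesis n_gt0 : (0 < n)%N.

Definition centered_weight i j : R := weight u i.+1 j.+1 - 1.

Local Notation y := centered_weight.
Local Notation K := (kernel_mx u n).
Local Notation r := (rowsum y n).

Definition total_weight : R := \sum_(i < n) rho u i.

Definition stationary_mx : 'M[R]_n := \matrix_(i, j) (rho u j / total_weight).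

Lemma total_weight_gt0 : 0 < total_weight.
Proof.
rewrite /total_weight (bigD1 (Ordinal n_gt0)) //= ltr_pwDl //.
by apply: sumr_ge0 => i _; exact: ltW.
Qed.

Lemma kernel_mxE i j : K i j = weight u i.+1 j.+1 / rho u i.
Proof. by rewrite mxE rho_gt0. Qed.

Lemma weight_sym i j : weight u i j = weight u j i.
Proof. by rewrite /weight minnC maxnC. Qed.

Lemma kernel_mul_stationary : K *m stationary_mx = stationary_mx.
Proof.
apply/matrixP => i j; rewrite mxE; under eq_bigr do rewrite kernel_mxE [stationary_mx _ _]mxE.
by rewrite -mulr_suml -mulr_suml -/(rho u i) mulfV ?gt_eqF // mul1r mxE.
Qed.

Lemma stationary_mul_kernel : stationary_mx *m K = stationary_mx.
Proof.
apply/matrixP => i j; rewrite mxE [RHS]mxE.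
transitivity (\sum_(k < n) weight u j.+1 k.+1 / total_weight).
  apply: eq_bigr => k _; rewrite kernel_mxE mxE weight_sym.
  by rewrite mulrC mulrA divfK ?gt_eqF.
by rewrite -mulr_suml.
Qed.

Lemma stationary_idem : stationary_mx *m stationary_mx = stationary_mx.
Proof.
apply/matrixP => i j; rewrite mxE [RHS]mxE; under eq_bigr do rewrite !mxE.
by rewrite -mulr_suml -mulr_suml -/total_weight mulfV ?gt_eqF ?total_weight_gt0 // mul1r.
Qed.

Lemma tr_stationary : \tr stationary_mx = 1.
Proof.
rewrite /mxtrace; under eq_bigr do rewrite mxE.
by rewrite -mulr_suml -/total_weight mulfV // gt_eqF // total_weight_gt0.
Qed.

(** [stationary_mx] is idempotent and absorbs [K] on both sides, so all cross terms collapse; the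
    exponent has to be positive. *)
Lemma kernel_sub_exp k : (K - stationary_mx) ^+ k.+1 = K ^+ k.+1 - stationary_mx.
Proof.
elim: k => [|k IH]; first by rewrite !expr1.
have PK : stationary_mx *m K ^+ k.+1 = stationary_mx.
  elim: k.+1 => [|m IHm]; first exact: mulmx1.
  by rewrite expmxS mulmxA stationary_mul_kernel.
rewrite expmxS IH mulmxBl !mulmxBr -expmxS kernel_mul_stationary PK stationary_idem.
by rewrite subrr subr0.
Qed.

Lemma tr_kernel_exp k : \tr (K ^+ k.+1) - 1 = \tr ((K - stationary_mx) ^+ k.+1).
Proof. by rewrite kernel_sub_exp linearB /= tr_stationary. Qed.

Lemma rho_rowsum (i : 'I_n) : rho u i = n%:R + r i 0.
Proof.
rewrite rowsumE /centered_weight sumrB sumr_const card_ord /rho.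
by rewrite addrC subrK.
Qed.

Lemma total_weightE : total_weight = n%:R ^+ 2 + \sum_(i < n) r i 0.
Proof.
rewrite /total_weight; under eq_bigr do rewrite rho_rowsum.
by rewrite big_split; congr (_ + _); rewrite sumr_const card_ord -[LHS]mulr_natr expr2.
Qed.

(* Subtracting the invariant law leaves, besides the centred weights, a sum of
   four rank-one matrices built from the constant vector and the row sums. *)
Definition fluct_mx : 'M[R]_n := ((sqn R n)^-1 / total_weight) *:
  ((\sum_(i < n) r i 0) *: (const_mx 1 *m (const_mx 1 : 'cV_n)^T)
   - n%:R *: (r *m (const_mx 1 : 'cV_n)^T) - n%:R *: (const_mx 1 *m r^T) - r *m r^T).

Definition degree_row : 'rV[R]_n := \row_i (n%:R / rho u i).

(** With [n / rho] factored out of each row, [w - rho i * rho j / W] remains, where [w] is the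
    weight and [W] the total weight. Put [w = 1 + y], [rho = n + r] and [W = n ^ 2 + S], with [S]
    the sum of the [r i]: the [n ^ 2] cancels in [W - rho i * rho j], leaving the four terms of
    [fluct_mx]. *)
Lemma scaled_kernelE :
  sqn R n *: (K - stationary_mx) = diag_mx degree_row *m (Ymx y n + fluct_mx).
Proof.
have s0 := sqn_gt0 R n_gt0; have t0 := total_weight_gt0.
apply/matrixP => i j; rewrite mul_diag_mx.
have addE (A B : 'M[R]_n) : (A + B) i j = A i j + B i j by rewrite mxE.
have oppE (A : 'M[R]_n) : (- A) i j = - A i j by rewrite mxE.
have scaleE a (A : 'M[R]_n) : (a *: A) i j = a * A i j by rewrite mxE.
have rank1E (a b : 'cV[R]_n) : (a *m b^T) i j = a i 0 * b j 0.
  by rewrite mxE big_ord1 mxE.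
rewrite [RHS]mxE /fluct_mx /Ymx !(addE, oppE, scaleE, rank1E) kernel_mxE.
rewrite [stationary_mx _ _]mxE [degree_row _ _]mxE [Xmx _ _ _ _]mxE.
rewrite ![const_mx _ _ _]mxE /trunc {1}/centered_weight.
have := rho_gt0 i; move: t0; rewrite !rho_rowsum total_weightE -(sqn_sqr R n).
move: (sqn R n) s0 (\sum_(_ < _) _) (r i 0) (r j 0) (weight _ _ _) => s s0 S ri rj w t0 ri0.
by field; rewrite !gt_eqF.
Qed.

End Kernel.

Section KernelMoments.
Variables (R : realType) (u : nat -> nat -> R) (c : R).
Local Notation y := (centered_weight u).
Hypothesis path_growth : forall q l,
  growth q (fun n => frob (path_mx (@trunc R y n) l) ^+ 2) l.+1.
Hypothesis cycle_growth : forall q l,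
  growth q (fun n => frob (cycle_mx (@trunc R y n) l) ^+ 2) l.+1.
Hypothesis pendant_growth : forall q l,
  growth q (fun n => frob (pendant_mx (@trunc R y n) (c ^+ 2) l.+1) ^+ 2) l.+2.
Hypothesis row_growth : forall q,
  growth q (fun n => \sum_(a < n) row_pairs (@trunc R y n) a ^+ 2) 3.

Lemma centered_weight_sym i j : y i j = y j i.
Proof. by rewrite /centered_weight weight_sym. Qed.

(** Forces [rho] to be at least [n / 2], which for [n > 0] excludes the default rows of the kernel.
    It is boolean so that it can guard an [if]. *)
Definition balanced n := [forall a : 'I_n, `|rowsum y n a 0| <= n%:R / 2].

Definition scaled_kernel n : 'M[R]_n := sqn R n *: (kernel_mx u n - stationary_mx u n).

Section Estimates.
Variables (p n : nat) (Cr Cx : R).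
Hypotheses (p_gt0 : (0 < p)%N) (n_gt0 : (0 < n)%N) (Cr0 : 0 <= Cr) (Cx0 : 0 <= Cx).
Hypothesis r_le : forall a : 'I_n, `|rowsum y n a 0| <= Cr * kap R p n ^+ 15.
Hypothesis X_op : opb (Xmx y n) (Cx * root16 R p n * sqn R n).
Hypothesis n_bal : balanced n.

Local Notation th := (root16 R p n).
Local Notation kp := (kap R p n).

Lemma balanced_rho_ge (a : 'I_n) : n%:R / 2 <= rho u a.
Proof.
have /forallP/(_ a) := n_bal; rewrite ler_norml => /andP[h _].
rewrite rho_rowsum; move: h; set x := rowsum _ _ _ _; lra.
Qed.

Lemma balanced_rho_gt0 (a : 'I_n) : 0 < rho u a.
Proof. by apply: lt_le_trans (balanced_rho_ge a); rewrite divr_gt0 ?ltr0n. Qed.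

Lemma frob_rowsum_le : frob (rowsum y n) <= Cx * th * kp ^+ 16.
Proof.
have := X_op (const_mx 1); rewrite frob_const1 -/(sqn R n) => /le_trans; apply.
by rewrite -!mulrA (@sqn_kap R p) // -exprD.
Qed.

Let Cf := 2 * (3 * Cx + Cx ^+ 2).

(** [phi] bounds the norm of the row sums. Each of the four terms has trace norm of order
    [th * kap ^ 40], the last one because [th <= kap]. The prefactor is at most [2 / kap ^ 40]:
    [kap ^ 8] is [sqn], and the total weight is at least [kap ^ 32 / 2]. *)
Lemma fluct_nucb : nucb (fluct_mx u n) (Cf * th).
Proof.
have k0 := kap_ge0 R p n; have t0 := root16_ge0 R p n.
have k1 := kap_ge1 R p n_gt0; have t1 := root16_ge1 R p n_gt0.
have tk : th <= kp by rewrite -[leLHS]expr1 ler_weXn2l.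
have kgt0 : 0 < kp by rewrite (lt_le_trans ltr01).
set phi := Cx * th * kp ^+ 16.
have phi0 : 0 <= phi by rewrite !mulr_ge0 ?exprn_ge0.
have r_phi : frob (rowsum y n) <= phi := frob_rowsum_le.
have one : frob (const_mx 1 : 'cV[R]_n) = kp ^+ 8 by rewrite frob_const1 -/(sqn R n) (@sqn_kap R p).
have S_le : `|\sum_(i < n) rowsum y n i 0| <= kp ^+ 8 * phi.
  have := frob_dot (const_mx 1) (rowsum y n); rewrite one => h.
  apply: le_trans (le_trans _ h) _; last by rewrite ler_wpM2l ?exprn_ge0.
  rewrite le_eqVlt; apply/orP; left; apply/eqP; congr Num.norm.
  by apply: eq_bigr => i _; rewrite big_ord1 [const_mx _ _ _]mxE mul1r.
have tw_ge : kp ^+ 32 / 2 <= total_weight u n.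
  apply: (@le_trans _ _ (\sum_(i < n) n%:R / 2)); last first.
    by apply: ler_sum => i _; exact: balanced_rho_ge.
  rewrite sumr_const card_ord -[leRHS]mulr_natr -(kap_exp R p_gt0 n).
  by rewrite [leRHS](_ : _ = kp ^+ 32 / 2) //; field.
have f_le : `|(sqn R n)^-1 / total_weight u n| <= 2 / kp ^+ 40.
  have tw0 : 0 < total_weight u n.
    by apply: lt_le_trans tw_ge; rewrite divr_gt0 // (exprn_gt0 _ kgt0).
  rewrite ger0_norm; last by rewrite mulr_ge0 ?invr_ge0 ?sqn_ge0 // ltW.
  rewrite (@sqn_kap R p) // [leRHS](_ : _ = (kp ^+ 8)^-1 * (kp ^+ 32 / 2)^-1); last first.
    by field; rewrite gt_eqF.
  rewrite ler_wpM2l ?invr_ge0 ?exprn_ge0 // lef_pV2 // posrE.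
  by rewrite divr_gt0 // (exprn_gt0 _ kgt0).
have nB (F G : 'M[R]_n) a b : nucb F a -> nucb G b -> nucb (F - G) (a + b).
  move=> Fa Gb; apply: nucbD => // Q q q0 Qq.
  by rewrite mulNmx linearN normrN; exact: Gb.
have rank1 (v w : 'cV[R]_n) a b : frob v <= a -> frob w <= b -> nucb (v *m w^T) (a * b).
  move=> va wb; apply: nucb_le (nucb_rank1 v w).
  by rewrite ler_pM ?frob_ge0.
have one_le : frob (const_mx 1 : 'cV[R]_n) <= kp ^+ 8 by rewrite one.
have inner : nucb ((\sum_(i < n) rowsum y n i 0) *: (const_mx 1 *m (const_mx 1 : 'cV_n)^T)
   - n%:R *: (rowsum y n *m (const_mx 1 : 'cV_n)^T) - n%:R *: (const_mx 1 *m (rowsum y n)^T)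
   - rowsum y n *m (rowsum y n)^T)
   (kp ^+ 8 * phi * (kp ^+ 8 * kp ^+ 8) + kp ^+ 16 * (phi * kp ^+ 8) + kp ^+ 16 * (kp ^+ 8 * phi) + phi * phi).
  have nE : `|n%:R| = kp ^+ 16 by rewrite normr_nat kap_exp.
  apply: (nB); last exact: rank1.
  apply: (nB); last by rewrite -nE; apply: nucbZ; exact: rank1.
  apply: (nB); last by rewrite -nE; apply: nucbZ; exact: rank1.
  apply: nucb_le (nucbZ _ (rank1 _ _ _ _ one_le one_le)).
  by rewrite ler_wpM2r // -exprD exprn_ge0.
apply: nucb_le (nucbZ _ inner).
apply: (@le_trans _ _ (2 / kp ^+ 40 * ((3 * Cx + Cx ^+ 2) * th * kp ^+ 40))); last first.
  rewrite le_eqVlt; apply/orP; left; apply/eqP; rewrite /Cf; field.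
  by rewrite gt_eqF.
rewrite ler_pM // ?addr_ge0 ?mulr_ge0 ?exprn_ge0 //.
have -> : (3 * Cx + Cx ^+ 2) * th * kp ^+ 40 = (3 * Cx * th * kp ^+ 40) + Cx ^+ 2 * th * kp ^+ 40 by ring.
apply: lerD; first by rewrite le_eqVlt; apply/orP; left; apply/eqP; rewrite /phi; ring.
rewrite /phi (_ : _ * _ = Cx ^+ 2 * th * (th * kp ^+ 32)); last by ring.
rewrite ler_wpM2l ?mulr_ge0 ?sqr_ge0 // -[40%N]/(8 + 32)%N exprD ler_wpM2r ?exprn_ge0 //.
by apply: le_trans tk _; rewrite -[leLHS]expr1 ler_weXn2l.
Qed.

Let Cg := Cx + Cf.
Let Cb := 2 * Cg + Cx.

(** [Cb * th] bounds the operator norms of both matrices, since [tr_telescope] takes a single bound;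
    their difference has trace norm of order [kap ^ 15 * th]. *)
Lemma scaled_kernel_estimate k :
  `|\tr (scaled_kernel n ^+ k.+1) - \tr (Ymx y n ^+ k.+1)| <=
  k.+1%:R * (2 * Cr * Cg + Cf) * Cb ^+ k * (kp ^+ 15 * th ^+ k.+1).
Proof.
have k0 := kap_ge0 R p n; have t0 := root16_ge0 R p n.
have k1 := kap_ge1 R p n_gt0; have t1 := root16_ge1 R p n_gt0.
have n0 : 0 < n%:R :> R by rewrite ltr0n.
have Cf0 : 0 <= Cf by rewrite /Cf !mulr_ge0 // addr_ge0 ?mulr_ge0 ?sqr_ge0.
have Cg0 : 0 <= Cg by exact: addr_ge0.
have s0 := sqn_gt0 R n_gt0.
have Y_op : opb (Ymx y n) (Cx * th).
  have := opbZ (sqn R n)^-1 X_op; apply: opb_le.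
  by rewrite ger0_norm ?invr_ge0 ?sqn_ge0 // mulrC mulfK ?gt_eqF.
have F_op := nucb_opb (mulr_ge0 Cf0 t0) fluct_nucb.
have G_op : opb (Ymx y n + fluct_mx u n) (Cg * th).
  by rewrite mulrDl; exact: opbD.
have E := scaled_kernelE balanced_rho_gt0 n_gt0.
have K_op : opb (scaled_kernel n) (Cb * th).
  rewrite /scaled_kernel E; apply: (@opb_le _ _ _ _ (2 * (Cg * th))).
    by rewrite mulrA ler_wpM2r // lerDl.
  apply: opbM => //; apply: opb_diag => // a; rewrite mxE.
  have ra := balanced_rho_gt0 a.
  rewrite ger0_norm; last by rewrite divr_ge0 // ltW.
  by rewrite ler_pdivrMr //; have := balanced_rho_ge a; lra.
have Y_op' : opb (Ymx y n) (Cb * th).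
  by apply: opb_le Y_op; rewrite ler_wpM2r // lerDr mulr_ge0.
have D_nuc : nucb (scaled_kernel n - Ymx y n) ((2 * Cr * Cg + Cf) * (kp ^+ 15 * th)).
  have -> : scaled_kernel n - Ymx y n =
      diag_mx (degree_row u n - const_mx 1) *m (Ymx y n + fluct_mx u n) + fluct_mx u n.
    rewrite /scaled_kernel E linearB /= diag_const_mx mulmxBl mul1mx.
    by rewrite opprD addrA subrK.
  (* The uniform row-sum bound enters here: [n / rho - 1] is [- r / rho] with [rho >= n / 2].
     Summing over the [n] diagonal entries cancels the [n] in the denominator. *)
  have d_le a : `|(degree_row u n - const_mx 1) 0 a| <= 2 * Cr * kp ^+ 15 / n%:R.
    have -> : (degree_row u n - const_mx 1) 0 a = n%:R / rho u a - 1 by rewrite !mxE.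
    have ra := balanced_rho_gt0 a.
    have -> : n%:R / rho u a - 1 = - rowsum y n a 0 / rho u a.
      by move: ra; rewrite rho_rowsum => ra; field; rewrite gt_eqF.
    rewrite normrM normrN normfV (gtr0_norm ra) ler_pdivrMr //.
    apply: le_trans (r_le a) _; have := balanced_rho_ge a.
    rewrite -(ler_pM2l (_ : 0 < 2 / n%:R)) ?divr_gt0 // => h.
    have -> : 2 * Cr * kp ^+ 15 / n%:R * rho u a = (Cr * kp ^+ 15) * (2 / n%:R * rho u a) by ring.
    rewrite -[leLHS]mulr1 ler_wpM2l ?mulr_ge0 ?exprn_ge0 //; apply: le_trans h.
    by rewrite le_eqVlt; apply/orP; left; apply/eqP; field; rewrite gt_eqF.
  apply: nucb_le (nucbD (nucb_diag_mul (mulr_ge0 Cg0 t0) d_le G_op) fluct_nucb).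
  rewrite [leRHS]mulrDl; apply: lerD.
    by rewrite le_eqVlt; apply/orP; left; apply/eqP; field; rewrite gt_eqF.
  by rewrite ler_wpM2l // ler_peMl // exprn_ege1.
have Cbt0 : 0 <= Cb * th by rewrite mulr_ge0 // /Cb addr_ge0 ?mulr_ge0.
apply: le_trans (tr_telescope k.+1 Cbt0 K_op Y_op' D_nuc) _.
by rewrite le_eqVlt; apply/orP; left; apply/eqP; rewrite /= exprMn [th ^+ k.+1]exprS; move: (k.+1%:R : R) => k1R; ring.
Qed.

End Estimates.

(** Row sums of order [kap ^ 15] against [n = kap ^ 16] leave one [kap], which eventually exceeds
    [Cr * 2]; [p = 1] suffices. *)
Lemma near_balanced : \forall i \near \oo, balanced i.+1.
Proof.
pose p := 1%N; have p_gt0 : (0 < p)%N by [].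
have [Cr Cr0 Hr] := rowsum_bound centered_weight_sym path_growth cycle_growth pendant_growth row_growth p_gt0.
near=> i; apply/forallP => a; apply: le_trans (Hr i a) _.
rewrite ler_pdivlMr // -(kap_exp R p_gt0 i.+1) [leRHS]exprSr mulrAC mulrC.
have k0 := kap_ge0 R p i.+1.
rewrite ler_wpM2l ?(exprn_ge0 15 k0) // -(@ler_pXn2r _ 16) ?nnegrE ?(mulr_ge0 Cr0) //.
rewrite kap_exp //.
apply: (@le_trans _ _ i%:R); last by rewrite ler_nat.
by near: i; exact: nbhs_infty_ger.
Unshelve. all: by end_near. Qed.

Lemma scaled_kernel_cvg k :
  \tr (scaled_kernel i.+1 ^+ k.+1) / i.+1%:R @[i --> \oo] --> (ballot k.+1 0)%:R * c ^+ k.+1.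
Proof.
(* Then [root16 ^ k.+2 = kap], so the error [kap ^ 15 * root16 ^ k.+1] stays exactly one factor
   [root16] below [n]. *)
pose p := k.+2; have p_gt0 : (0 < p)%N by [].
have [Cr Cr0 Hr] := rowsum_bound centered_weight_sym path_growth cycle_growth pendant_growth row_growth p_gt0.
have [Cx Cx0 Hx] := Xmx_opb centered_weight_sym path_growth cycle_growth pendant_growth p_gt0.
have hY := tr_Ymx_cvg centered_weight_sym path_growth cycle_growth pendant_growth p_gt0 (leqnSn k.+1).
pose D i := \tr (scaled_kernel i.+1 ^+ k.+1) - \tr (Ymx y i.+1 ^+ k.+1).
pose Cf := 2 * (3 * Cx + Cx ^+ 2).
pose K := k.+1%:R * (2 * Cr * (Cx + Cf) + Cf) * (2 * (Cx + Cf) + Cx) ^+ k.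
have Cf0 : 0 <= Cf by rewrite mulr_ge0 // addr_ge0 ?mulr_ge0 ?sqr_ge0.
have K0 : 0 <= K.
  rewrite /K !mulr_ge0 ?exprn_ge0 //; first by rewrite addr_ge0 // !mulr_ge0 // addr_ge0.
  by rewrite addr_ge0 // mulr_ge0 // addr_ge0.
(* The estimate requires [balanced], while [dominated] asks for a bound at every index; the value 0
   fills the finitely many exceptions. *)
have hD : `|if balanced i.+1 then D i else 0| / i.+1%:R @[i --> \oo] --> 0.
  apply: (@dominated_cvg0 R p p_gt0 _ (fun i => kap R p i.+1 ^+ 15 * root16 R p i.+1 ^+ k.+1)).
  - by move=> i; exact: normr_ge0.
  - exists K => // i; have k0 := kap_ge0 R p i.+1; have t0 := root16_ge0 R p i.+1.
    have := @scaled_kernel_estimate p i.+1 Cr Cx p_gt0 (ltn0Sn i) Cr0 Cx0 (Hr i) (Hx _ (ltn0Sn i)).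
    case: ifP => [bal /(_ isT k)|_ _]; first exact.
    by rewrite normr0 mulr_ge0 // mulr_ge0 // exprn_ge0.
  - by move=> i; rewrite -mulrA -exprSr -(kap_exp R p_gt0) [leRHS]exprSr.
have hD' : D i / i.+1%:R @[i --> \oo] --> 0.
  apply/norm_cvg0P; apply: cvg_trans hD; apply: near_eq_cvg.
  near=> i; have -> : balanced i.+1 by near: i; exact: near_balanced.
  by rewrite /= normrM normfV (ger0_norm (ler0n _ _)).
have h2 : D i / i.+1%:R + \tr (Ymx y i.+1 ^+ k.+1) / i.+1%:R @[i --> \oo] -->
    (0 + (ballot k.+1 0)%:R * c ^+ k.+1 : R) by exact: cvgD hD' hY.
rewrite add0r in h2; apply: cvg_trans h2; apply: near_eq_cvg; apply: nearW => i.
by rewrite /= -mulrDl subrK.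
Unshelve. all: by end_near. Qed.

Lemma return_prob_cvg k :
  (n%:R `^ (k%:R / 2 - 1) * ((\sum_(i < n) return_prob u k i) - 1) : R) @[n --> \oo] -->
  (if odd k then 0 else c ^+ k / (k./2.+1)%:R * 'C(k, k./2)%:R : R).
Proof.
have lim : (if odd k then 0 else c ^+ k / (k./2.+1)%:R * 'C(k, k./2)%:R : R) = (ballot k 0)%:R * c ^+ k.
  have [ok|ek] := boolP (odd k); first by rewrite ballot_odd ?mul0r // addn0.
  have e : k = (k./2).*2 by rewrite -[LHS](odd_double_half k) (negPf ek).
  have := ballot_catalan k./2; rewrite -e => <-; rewrite natrM.
  by rewrite mulrA divfK ?pnatr_eq0 // mulrC.
rewrite lim -cvg_shiftS.
have pow i : (i.+1%:R `^ (k%:R / 2 - 1) : R) = sqn R i.+1 ^+ k / i.+1%:R.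
  rewrite powRD ?pnatr_eq0 ?implybT // powRN powRr1 //.
  by rewrite (mulrC k%:R) powRrM powR12_sqrt // powR_mulrn ?sqrtr_ge0.
case: k lim pow => [|k] lim pow.
  have h : 1 - (i.+1%:R : R)^-1 @[i --> \oo] --> (1 - 0 : R).
    apply: cvgB; first exact: cvg_cst.
    exact: cvg_harmonic.
  rewrite subr0 in h; rewrite /= mulr1; apply: cvg_trans h; apply: near_eq_cvg; apply: nearW => i.
  rewrite pow expr0 mul1r /return_prob; under eq_bigr do rewrite expr0 mxE eqxx.
  by rewrite sumr_const card_ord mulrBr mulr1 mulVf ?pnatr_eq0.
have h := @scaled_kernel_cvg k; apply: cvg_trans h; apply: near_eq_cvg.
near=> i.
have bal : balanced i.+1 by near: i; exact: near_balanced.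
rewrite [RHS]/= pow [LHS]/= /scaled_kernel expmxZ linearZ /= -tr_kernel_exp //; last exact: balanced_rho_gt0.
by rewrite mulrAC.
Unshelve. all: by end_near. Qed.

End KernelMoments.

Section AlmostSureGrowth.
Context d (T : measurableType d) (R : realType) (P : probability T R).

Lemma ae_growth (Z : nat -> T -> R) a : (forall n t, 0 <= Z n t) ->
  (exists2 C, 0 <= C & forall n, exists2 m, has_mean P (Z n) m & m <= C * n%:R ^+ a) ->
  {ae P, forall t q, growth q (Z ^~ t) a}.
Proof.
move=> Z0 [C C0 HZ]; apply: ae_foralln => q.
have := @ae_power_bound _ T R P (fun n t => (n%:R ^+ a)^-1 * Z n t) C q.
have inv0 n : 0 <= (n%:R ^+ a)^-1 :> R by rewrite invr_ge0 exprn_ge0.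
have H1 n t : 0 <= (n%:R ^+ a)^-1 * Z n t by rewrite mulr_ge0.
have H2 n : exists2 m, has_mean P (fun t => (n%:R ^+ a)^-1 * Z n t) m & m <= C.
  have [m hm le_m] := HZ n; exists ((n%:R ^+ a)^-1 * m); first exact: has_meanZ.
  apply: le_trans (ler_wpM2l (inv0 n) le_m) _; rewrite mulrC -mulrA.
  (* The zero case is [n = 0] with [a > 0]: the inverse is 0 by convention and [0 <= C] remains. *)
  have [->|n0] := eqVneq (n%:R ^+ a : R) 0; first by rewrite mul0r mulr0.
  by rewrite mulfV // mulr1.
move=> /(_ H1 H2); apply: filterS => t [K K0 HK]; exists K => // m.
by have := HK m; rewrite mulrC ler_pdivrMr // exprn_gt0 // ltr0n expn_gt0.
Qed.

End AlmostSureGrowth.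

Theorem corollary1p4 (R : realType) (d : measure_display)
    (T : measurableType d) (P : probability T R)
    (L : probability (measurableTypeR R) R)
    (U : nat -> nat -> {RV P >-> measurableTypeR R})
    (U_iid : iid_triangular_array L U)
    (L_supp : L [set x : R | 0 <= x] = 1%E)
    (L_mean : law_mean L = 1%E)
    (L_var : (0 < law_variance L < +oo)%E)
    (L_moment4 : (\int[L]_x (x ^+ 4)%:E < +oo)%E) :
  {ae P, forall w : T, forall k : nat,
    (n%:R `^ (k%:R / 2 - 1) *
       ((\sum_(i < n) return_prob (fun a b => U a b w) k i) - 1) : R)
      @[n --> \oo] -->
    (if odd k then 0
     else law_sigma L ^+ k / (k./2.+1)%:R * 'C(k, k./2)%:R : R)}.
Proof.
have [c [kappa [g0 gg kappa1 c_le]]] := gfun_moments L_mean L_moment4.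
have path l := @ae_growth _ T R P _ _ (fun n t => sqr_ge0 _)
  (path_mx_moment U_iid g0 gg kappa1 c_le l).
have cycle l := @ae_growth _ T R P _ _ (fun n t => sqr_ge0 _)
  (cycle_mx_moment U_iid g0 gg kappa1 c_le l).
have pendant l := @ae_growth _ T R P _ _ (fun n t => sqr_ge0 _)
  (pendant_mx_moment U_iid g0 gg kappa1 c_le l).
have row := @ae_growth _ T R P _ _ (fun n t => sumr_ge0 _ (fun a _ => sqr_ge0 _))
  (row_pairs_moment U_iid g0 gg kappa1 c_le).
(* Countably many growth bounds, over all [q] and [l], make up one almost sure event fixed before
   [k]; on it the convergence is deterministic. *)
apply: filterS2 (filterI (ae_foralln path) (ae_foralln cycle)) (filterI (ae_foralln pendant) row).
move=> w [Hp Hc] [Hd Hr] k.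
by apply: return_prob_cvg => *; [exact: Hp | exact: Hc | exact: Hd | exact: Hr].
Qed.
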